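(* Let $G$ be an even polygonal chain and let $(B_1,B_2,\ldots,B_m)$ be the all-kink decomposition of $G$. Then $Af(G)=\sum_{t=1}^{m}r(B_t)$.
   Context: All graphs are finite and simple. For a perfect matching $M$ of $G$, a set $S\subseteq E(G)\setminus M$ is an anti-forcing set of $M$ if $M$ is the unique perfect matching of $G-S$; $af(G,M)$ is the minimum cardinality of an anti-forcing set of $M$. $Af(G)$ is the maximum of $af(G,M)$ over all perfect matchings $M$ of $G$. $r(H)=|E(H)|-|V(H)|+1$ is the cyclomatic number of a connected graph $H$ (for a chain, the number of its face cycles). A connected plane graph is outerplane if all its vertices lie on the boundary of the exterior face. A face cycle is the boundary of an interior face when it is a cycle; two face cycles are adjacent if they share an edge. An even polygonal chain is a 2-connected plane bipartite graph that is outerplane and in which each face cycle is adjacent to at most two other face cycles. An edge is shared if it is the common edge of two face cycles. A face cycle of a chain is terminal if it has only one shared edge of the chain. A face cycle $s$ of a chain is a kink of that chain if it has two shared edges (of that chain) that can be contained simultaneously in a perfect matching of the cycle $s$. A chain is all-kink if all its face cycles other than the terminal ones are kinks of it; a chain consisting of a single face cycle is regarded as all-kink. The operation $\ominus$: let $G$ be a graph with a perfect matching and $G'$ a subgraph such that some perfect matching of $G$ restricts to a perfect matching of $G'$. Starting from $G-V(G')$, as long as the current graph has a pendant edge (an edge with an end of degree one), delete both ends of pendant edges together with all edges incident to them; repeat until no pendant edges remain. The resulting (possibly empty) graph is $G\ominus G'$. All-kink decomposition: label the face cycles of an even polygonal chain $G$ as $s_1,\ldots,s_n$ from left to right along the chain.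 Its first maximal all-kink subchain is $B_1=s_1+s_2+\cdots+s_i$ (the union of these face cycles), where $B_1$ is all-kink and either $i=n$ or $B_1+s_{i+1}$ is not all-kink. Put $G_1=G$. If $G_2:=G_1\ominus B_1\neq\emptyset$, then $G_2$ is a subchain (an even polygonal chain consisting of a final part of the sequence of face cycles); let $B_2$ be its first maximal all-kink subchain from its left end, $G_3:=G_2\ominus B_2$, and so on, until $G_m\ominus B_m=\emptyset$. The sequence $(B_1,\ldots,B_m)$ is the all-kink decomposition of $G$. *)

(* Defs.v *)
From HB Require Import structures.
From mathcomp Require Import all_boot.

Set Implicit Arguments.
Unset Strict Implicit.
Unset Printing Implicit Defensive.

Section Graphs.
Variable T : finType.

(* A vertex set together with an edge set, an edge being the set of its two
   ends. All the graphs considered are subgraphs of one ambient simple graph. *)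
Definition graph : Type := ({set T} * {set {set T}})%type.

Implicit Types (H K : graph) (x y : {set T}) (M N S : {set {set T}}).

Definition vset H : {set T} := H.1.
Definition eset H : {set {set T}} := H.2.

Definition empty_graph : graph := (set0, set0).

Definition union_graph (c : seq graph) : graph :=
  (\bigcup_(H <- c) vset H, \bigcup_(H <- c) eset H).

Definition del_vertices H (X : {set T}) : graph :=
  (vset H :\: X, [set x in eset H | [disjoint x & X]]).

Definition del_edges H S : graph := (vset H, eset H :\: S).

Definition degree H (v : T) : nat := #|[set x in eset H | v \in x]|.

(* No truncation occurs for a connected graph. *)
Definition cyclomatic H : nat := #|eset H| + 1 - #|vset H|.

Definition perfect_matching H M : bool :=
  (M \subset eset H) && [forall v in vset H, #|[set x in M | v \in x]| == 1].

Definition anti_forcing H M S : bool :=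
  (S \subset eset H :\: M) &&
  [forall N, perfect_matching (del_edges H S) N == (N == M)].

(* For a perfect matching M the default set, all the edges outside M, is
   anti-forcing, so this is a genuine minimum. *)
Definition af H M : nat :=
  #|[arg min_(S < eset H :\: M | anti_forcing H M S) #|S|]|.

Definition Af H : nat := \max_(M | perfect_matching H M) af H M.

Definition pendant H x : bool :=
  (x \in eset H) && [exists v in x, degree H v == 1].

Inductive strips_to : graph -> graph -> Prop :=
| strips_done H : (forall x, ~~ pendant H x) -> strips_to H H
| strips_step H K x :
    pendant H x -> strips_to (del_vertices H x) K -> strips_to H K.

Definition subgraph K H : bool :=
  (vset K \subset vset H) && (eset K \subset eset H).

(* K is a result of H (-) H'. The order in which pendant edges are removed is
   left free. *)
Definition ominus H H' K : Prop :=
  [/\ subgraph H' H,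
      exists M, perfect_matching H M /\ perfect_matching H' (M :&: eset H')
    & strips_to (del_vertices H (vset H')) K].

(* A chain is represented below by the sequence of its face cycles. *)
Implicit Types (c : seq graph) (s : graph).

Definition adjacent s s' : bool := (s != s') && (eset s :&: eset s' != set0).

Definition shared c x : bool :=
  has (fun s => has (fun s' => (s != s') && (x \in eset s :&: eset s')) c) c.

Definition shared_edges c s : {set {set T}} := [set x in eset s | shared c x].

Definition terminal c s : bool := #|shared_edges c s| == 1.

Definition kink c s : bool :=
  [exists x in shared_edges c s, exists y in shared_edges c s,
    (x != y) && [exists M, [&& perfect_matching s M, x \in M & y \in M]]].

Definition all_kink c : bool :=
  (size c == 1) || all (fun s => ~~ terminal c s ==> kink c s) c.

(* The first i face cycles of c form its first maximal all-kink subchain. *)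
Definition first_maximal_all_kink c i : Prop :=
  [/\ 0 < i <= size c,
      all_kink (take i c)
    & i = size c \/ ~~ all_kink (take i.+1 c)].

(* H is the current chain G_t and c the sequence of its face cycles. *)
Inductive all_kink_decomposition : graph -> seq graph -> seq graph -> Prop :=
| decomposition_last H c i :
    first_maximal_all_kink c i ->
    ominus H (union_graph (take i c)) empty_graph ->
    all_kink_decomposition H c [:: union_graph (take i c)]
| decomposition_step H c i k K Bs :
    first_maximal_all_kink c i ->
    ominus H (union_graph (take i c)) K ->
    K != empty_graph ->
    K = union_graph (drop k c) ->
    all_kink_decomposition K (drop k c) Bs ->
    all_kink_decomposition H c (union_graph (take i c) :: Bs).

End Graphs.

Section Faces.
Variables (V : finType) (e : rel V) (rot : V -> V -> V).

Definition darts : {set V * V} := [set d | e d.1 d.2].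

Definition edges : {set {set V}} := [set [set d.1; d.2] | d in darts].

Definition face_step (d : V * V) : V * V := (d.2, rot d.2 d.1).

Definition face_of (d : V * V) : {set V * V} := [set d' | fconnect face_step d d'].

Definition faces : {set {set V * V}} := [set face_of d | d in darts].

End Faces.

(* A connected plane simple graph with at least one edge, up to homeomorphism
   of the plane, as a combinatorial map: rot v lists the neighbours of v in
   their cyclic order around v (its values off the neighbours of v are
   irrelevant), the faces are the orbits of face_step on darts, planarity is
   Euler's formula, and one face is designated as the exterior one. *)
Record plane_graph := PlaneGraph {
  vertex :> finType;
  adj : rel vertex;
  rot : vertex -> vertex -> vertex;
  exterior : {set vertex * vertex};
  _ : symmetric adj;
  _ : irreflexive adj;
  _ : forall u v, connect adj u v;
  _ : forall v u, adj v u -> adj v (rot v u);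
  _ : forall v u w, adj v u -> adj v w -> fconnect (rot v) u w;
  _ : #|vertex| + #|faces adj rot| = #|edges adj| + 2;
  _ : exterior \in faces adj rot
}.

Section PlaneGraphs.
Variable G : plane_graph.

Definition graph_of : graph G := ([set: G], edges (@adj G)).

Definition two_connected : Prop :=
  2 < #|G| /\
  forall w u v : G, u != w -> v != w ->
    connect [rel x y | [&& adj x y, x != w & y != w]] u v.

Definition bipartite : Prop :=
  exists color : G -> bool, forall u v : G, adj u v -> color u != color v.

Definition outerplane : Prop :=
  forall v : G, exists2 d, d \in exterior G & d.1 = v.

Definition boundary (f : {set G * G}) : graph G :=
  ([set d.1 | d in f], [set [set d.1; d.2] | d in f]).

(* The boundary walk of the face visits no vertex twice. *)
Definition bounded_by_cycle (f : {set G * G}) : bool :=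
  (2 < #|f|) && (#|[set d.1 | d in f]| == #|f|).

Definition face_cycles : {set graph G} :=
  [set boundary f | f in faces (@adj G) (@rot G)
                  & (f != exterior G) && bounded_by_cycle f].

Definition even_polygonal_chain : Prop :=
  [/\ two_connected, bipartite, outerplane
    & forall s, s \in face_cycles ->
        #|[set s' in face_cycles | adjacent s s']| <= 2].

Definition left_to_right (c : seq (graph G)) : Prop :=
  [/\ uniq c, c =i face_cycles & sorted (@adjacent G) c].

End PlaneGraphs.

(* Main.v *)
(* Cut along its shared edges, the chain is a ladder: two disjoint paths joined by
   rungs. For a perfect matching every rung is used, or both its ends are matched to
   the left, or both to the right. The state of the left rung of a face leaves for
   its right rung either the state left alone or a choice between used and
   right; which of the two depends on whether the face is a kink. So a matching is
   a word over a small automaton.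

   Upper bound: deleting a suitable unmatched edge of a face whose right rung is
   used or matched to the right destroys all the alternating cycles through that
   face. Along a run of non-kinks two deletions suffice, along kinks one per
   face, which is the recursion [bounds]. Lower bound: a matching can be chosen so
   that as many faces are alternating, any two of them sharing only matching edges;
   an anti-forcing set meets all of them in different edges. Stripping pendant edges
   after a maximal all-kink subchain runs through the non-kinks and stops behind the
   first kink, so the decomposition follows the same recursion.

   That an outerplane 2-connected map is such a ladder needs no Jordan curve
   argument: connectedness of suitable incidence graphs of faces, edges and vertices,
   confronted with Euler's formula, shows that the exterior face visits each vertex
   once and that inner faces and edges form a tree under incidence. The number of
   vertices then forces consecutive faces to meet in their shared edge only. *)

Require Import Defs.
From HB Require Import structures.
From mathcomp Require Import all_boot.
From mathcomp Require Import zify.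

Set Implicit Arguments.
Unset Strict Implicit.
Unset Printing Implicit Defensive.

(** * Matchings of paths and ladders *)

(** Spending one deletion on every face is too expensive in a long run of non-kinks. The saving
    comes from deletion sets that determine the matching whatever the state of the left rung: if the
    part to the right is fixed in this strong sense, its state can be read backwards and the face
    before it costs nothing. This is why [forcible] carries a predicate on left states and why the
    induction for the upper bound offers two alternatives, one paying an extra deletion for this
    independence.

    The right rung of the last face is not shared, so it can be chosen freely; choosing it to make
    that face a kink keeps every non-kink followed by another face.

    In the decomposition neither the order of stripping nor the index at which the chain resumes is
    given. A perfect matching contains all pendant edges, hence they are disjoint and their removals
    commute, so the result is unique; counting its vertices then recovers the index. *)

Section Matchings.
Variable T : finType.
Implicit Types (x y : {set T}) (E M N S : {set {set T}}) (X Y : {set T}).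

Definition cover_num M (v : T) : nat := #|[set x in M | v \in x]|.

Definition matches E X M : bool :=
  (M \subset E) && [forall v, cover_num M v == (v \in X)].

Lemma matchesP E X M :
  reflect (M \subset E /\ forall v, cover_num M v = (v \in X)) (matches E X M).
Proof.
apply: (iffP andP) => -[sME cM]; split=> //; first by move=> v; apply/eqP; move: v; apply/forallP.
by apply/forallP => v; rewrite cM.
Qed.

Lemma matches_sub E X M : matches E X M -> M \subset E.
Proof. by case/andP. Qed.

Lemma matches_inj E X M x y (v : T) :
  matches E X M -> x \in M -> y \in M -> v \in x -> v \in y -> x = y.
Proof.
case/matchesP => _ cM xM yM vx vy.
have /card_le1_eqP: cover_num M v <= 1 by rewrite cM leq_b1.
by apply; rewrite inE ?xM ?yM.
Qed.

Lemma matches_mem E X M x (v : T) :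
  matches E X M -> x \in M -> v \in x -> v \in X.
Proof.
case/matchesP => _ cM xM vx; have: 0 < cover_num M v.
  by apply/card_gt0P; exists x; rewrite inE xM.
by rewrite cM; case: (v \in X).
Qed.

Lemma matches_ex E X M (v : T) :
  matches E X M -> v \in X -> exists2 x, x \in M & v \in x.
Proof.
case/matchesP => _ cM vX; have: 0 < cover_num M v by rewrite cM vX.
by case/card_gt0P=> x; rewrite inE => /andP[]; exists x.
Qed.

Lemma matches_eq E X M N :
  set0 \notin M -> matches E X M -> matches E X N -> N \subset M -> N = M.
Proof.
move=> M0 pM pN sNM; apply/eqP; rewrite eqEsubset sNM; apply/subsetP => x xM.
have /set0Pn[v vx]: x != set0 by apply: contraNneq M0 => <-.
have [y yN vy] := matches_ex pN (matches_mem pM xM vx).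
by rewrite (matches_inj pM xM (subsetP sNM _ yN) vx vy).
Qed.

Lemma cover_numU1 M x (v : T) :
  x \notin M -> cover_num (x |: M) v = (v \in x) + cover_num M v.
Proof.
move=> xM; rewrite /cover_num.
case: (boolP (v \in x)) => vx.
  have -> : [set y in x |: M | v \in y] = x |: [set y in M | v \in y].
    by apply/setP => y; rewrite !inE; case: eqVneq => [->|]; rewrite ?vx.
  by rewrite cardsU1 inE (negPf xM).
congr #|pred_of_set _|; apply/setP => y; rewrite !inE.
by case: eqVneq => [->|] //=; rewrite (negPf vx) !andbF.
Qed.

Lemma matches_add E X M x :
  [disjoint x & X] -> matches E X M -> matches (x |: E) (x :|: X) (x |: M).
Proof.
move=> dxX; have [->|/set0Pn[u ux]] := eqVneq x set0.
  case/matchesP => sME cM; apply/matchesP; split; first by rewrite setUS.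
  move=> v; rewrite set0U -cM /cover_num; congr #|pred_of_set _|.
  by apply/setP => y; rewrite !inE; case: eqVneq => [->|] //; rewrite in_set0 !andbF.
move=> pM; have xM: x \notin M.
  by apply/negP => xM; have := disjointFr dxX ux; rewrite (matches_mem pM xM ux).
case/matchesP: pM => sME cM; apply/matchesP; split; first by rewrite setUS.
move=> v; rewrite cover_numU1 // cM inE.
by case: (boolP (v \in x)) => //= vx; rewrite (disjointFr dxX vx).
Qed.

Lemma matches_rem E X M x :
  x \in M -> matches E X M -> matches E (X :\: x) (M :\ x).
Proof.
move=> xM pM; apply/matchesP; split.
  by apply: subset_trans (matches_sub pM); rewrite subsetDl.
have [_ cM] := matchesP _ _ _ pM.
move=> v; have := cM v; rewrite -{1}(setD1K xM) cover_numU1 ?setD11 // inE.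
by case: (v \in x); case: (v \in X) => //= -[].
Qed.

Lemma matches_weak E E' X M : M \subset E' -> matches E X M -> matches E' X M.
Proof. by move=> sM /andP[_ pM]; apply/andP. Qed.

Lemma matchesU1 E X M x : x \notin E ->
  matches (x |: E) X M ->
  if x \in M then x \subset X /\ M = x |: (M :&: E) /\ matches E (X :\: x) (M :&: E)
  else M = M :&: E /\ matches E X (M :&: E).
Proof.
move=> xE pM; have sM := matches_sub pM.
have eqM : M :\ x = M :&: E.
  apply/setP => y; rewrite !inE; case: eqVneq => [->|yx] /=; first by rewrite (negPf xE) andbF.
  case: (boolP (y \in M)) => //= yM.
  by have := subsetP sM _ yM; rewrite !inE (negPf yx).
case: ifP => xM; rewrite -eqM.
  split; first by apply/subsetP => v; apply: matches_mem pM xM.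
  rewrite setD1K //; split=> //.
  by apply: matches_weak (matches_rem xM pM); rewrite eqM subsetIr.
have eM: M :\ x = M by apply/setDidPl; rewrite disjoint_sym disjoints1 xM.
rewrite !eM; split=> //.
by apply: matches_weak pM; rewrite -eM eqM subsetIr.
Qed.

End Matchings.

(** * Matchings along a path attached to a graph at its last vertex *)

Section Paths.
Variable T : finType.
Implicit Types (x y : {set T}) (E M N S : {set {set T}}) (X Y : {set T}).
Implicit Types (a b c d v : T) (A B : seq T).

Fixpoint path_edges c A : {set {set T}} :=
  if A is a :: A' then [set c; a] |: path_edges a A' else set0.

(* Every second edge of the path, the first one included when [p] holds. *)
Fixpoint alt_edges c A (p : bool) : {set {set T}} :=
  if A is a :: A' then
    (if p then [set [set c; a]] else set0) :|: alt_edges a A' (~~ p)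
  else set0.

Lemma path_edges_sub c A x : x \in path_edges c A -> x \subset [set v in c :: A].
Proof.
elim: A c => [|a A IH] c /=; first by rewrite inE.
case/setU1P=> [->|/IH/subsetP sx].
  by apply/subsetP => v; rewrite !inE => /orP[]/eqP->; rewrite eqxx ?orbT.
by apply/subsetP => v /sx; rewrite !inE => ->; rewrite orbT.
Qed.

Lemma path_edges_memP c A x v :
  x \in path_edges c A -> v \in x -> v \in c :: A.
Proof. by move/path_edges_sub/subsetP => sx /sx; rewrite inE. Qed.

Lemma path_edges_belast c A x :
  x \in path_edges c A -> exists2 v, v \in belast c A & v \in x.
Proof.
elim: A c => [|a A IH] c /=; first by rewrite inE.
case/setU1P=> [->|/IH[v vA vx]]; first by exists c; rewrite !inE eqxx.
by exists v; rewrite // inE vA orbT.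
Qed.

Lemma alt_edges_sub c A p : alt_edges c A p \subset path_edges c A.
Proof.
elim: A c p => [|a A IH] c p /=; first exact: sub0set.
by apply: setUSS (IH _ _); case: p; rewrite ?sub0set.
Qed.

Definition fresh (s : seq T) E := forall v x, v \in s -> x \in E -> v \notin x.

Lemma path_edges_fresh c A E : fresh (belast c A) E -> [disjoint path_edges c A & E].
Proof.
move=> fE; apply/pred0P => x; apply/negP => /andP[/=/path_edges_belast[v vA vx]].
by move/(fE v x vA); rewrite vx.
Qed.

(** Only the last vertex of the path meets [E], so there is no choice along it: whether [c] has to
    be covered decides the first edge, the first edge decides the second, and so on. All that [E]
    inherits is a possible demand at the last vertex, given by a parity. *)
Lemma matches_path c A E X M :
  uniq (c :: A) -> fresh (belast c A) E -> {subset A <= X} ->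
  matches (path_edges c A :|: E) X M ->
  M = alt_edges c A (c \in X) :|: (M :&: E) /\
  matches E (X :\: [set v in c :: A] :|:
     (if (c \in X) (+) odd (size A) then [set last c A] else set0)) (M :&: E).
Proof.
elim: A c X M => [|a A IH] c X M /= Uc fE sAX.
  rewrite set0U => pM; have -> : M :&: E = M by apply/setIidPl; apply: matches_sub pM.
  rewrite set0U addbF; split=> //; congr (matches _ _ _): pM.
  apply/setP => v; rewrite !inE; case: eqVneq => [->|nvc] /=; first by case: ifP; rewrite inE ?eqxx.
  by case: ifP; rewrite !inE ?(negPf nvc) ?orbF.
case/andP: Uc => cA Ua.
have cE x : x \in path_edges a A :|: E -> c \notin x.
  case/setUP => [xA|]; last by apply: fE; rewrite mem_head.
  by apply: contra cA => cx; apply: path_edges_memP xA cx.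
have xE: [set c; a] \notin path_edges a A :|: E.
  by apply/negP => /cE; rewrite !inE eqxx.
have fE' : fresh (belast a A) E by move=> v x vA; apply: fE; rewrite inE vA orbT.
have ca: c != a by apply: contraNneq cA => ->; rewrite mem_head.
have {}cA: c \notin A by apply: contra cA; rewrite inE => ->; rewrite orbT.
have aA: a \notin A by case/andP: Ua.
have aX: a \in X by apply: sAX; rewrite mem_head.
have IE N : N :&: (path_edges a A :|: E) :&: E = N :&: E.
  by apply/setP => y; rewrite !inE; case: (y \in E); rewrite ?orbT ?andbT ?andbF.
rewrite -setUA => pM; have := matchesU1 xE pM; case: ifP => xM.
  case=> xX [eM pM']; have cX: c \in X by apply: subsetP xX _ _; rewrite !inE eqxx.
  have sA' : {subset A <= X :\: [set c; a]}.
    move=> v vA; rewrite !inE sAX ?inE ?vA ?orbT // andbT negb_or.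
    by apply/andP; split; [apply: contraNneq cA | apply: contraNneq aA] => <-.
  have [] := IH _ _ _ Ua fE' sA' pM'.
  rewrite IE cX !inE eqxx orbT /= => eM' pM''; split.
    by rewrite {1}eM eM' setUA.
  rewrite negbK; congr (matches _ _ _): pM''; congr (_ :|: _).
  by apply/setP => v; rewrite !inE; case: (v == c); case: (v == a); case: (v \in A); case: (v \in X).
case=> eM pM'; have cX : c \notin X.
  apply/negP => cX; have [y yM cy] := matches_ex pM cX.
  move: (subsetP (matches_sub pM) _ yM); case/setU1P => [eyx|yE].
    by move: xM; rewrite -eyx yM.
  by move: (cE _ yE); rewrite cy.
have sA' : {subset A <= X} by move=> v vA; rewrite sAX // inE vA orbT.
have [] := IH _ _ _ Ua fE' sA' pM'.
rewrite IE (negPf cX) /= aX /= => eM' pM''; split; first by rewrite set0U {1}eM.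
congr (matches _ _ _): pM''; congr (_ :|: _).
apply/setP => v; rewrite !inE; have [->|] := eqVneq v c.
  by rewrite (negPf cX) !andbF.
by [].
Qed.

Lemma matches_path_add c A E Y M p :
  uniq (c :: A) -> {in belast c A, forall v, v \notin Y} ->
  (last c A \in Y) = p (+) odd (size A) ->
  matches E Y M ->
  matches (path_edges c A :|: E)
    (Y :|: [set v in A] :|: (if p then [set c] else set0)) (alt_edges c A p :|: M).
Proof.
move=> + + + pM; elim: A c p => [|a A IH] c p /= Uc fY.
  rewrite addbF => cp; rewrite !set0U; congr (matches _ _ _): pM.
  apply/setP => v; rewrite !inE; case: p cp => cp; rewrite !inE ?orbF //.
  by case: eqVneq => [->|]; rewrite ?cp ?orbF.
case/andP: Uc => cA Ua lY.
have fY' : {in belast a A, forall v, v \notin Y}.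
  by move=> v vA; apply: fY; rewrite inE vA orbT.
have lY': (last a A \in Y) = ~~ p (+) odd (size A) by rewrite lY; case: (p); case: odd.
have {IH} := IH a (~~ p) Ua fY' lY'.
case: p lY lY' => /= lY lY' pM'; last first.
  rewrite set0U.
  have := matches_weak (subset_trans (matches_sub pM') (subsetUr [set [set c; a]] _)) pM'.
  rewrite setUA; congr (matches _ _ _).
  by apply/setP => v; rewrite !inE; case: (v == a); case: (v \in A); case: (v \in Y).
have cY : c \notin Y by rewrite fY ?mem_head.
have aY : a \notin Y.
  move: fY lY; case: (A) => [|a' A'] /= fY; first by move=> ->.
  by rewrite fY // !inE eqxx orbT.
have ad: [disjoint [set c; a] & Y :|: [set v in A] :|: set0].
  apply/pred0P => v /=; rewrite !inE orbF; apply/negP => /andP[/orP[]/eqP->].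
    by rewrite (negPf cY) /=; move: cA; rewrite inE negb_or => /andP[_ /negPf->].
  by rewrite (negPf aY) /=; case/andP: Ua => /negPf->.
have := matches_add ad pM'; rewrite -!setUA.
congr (matches _ _ _); apply/setP => v; rewrite !inE.
by case: (v == c); case: (v == a); case: (v \in A); case: (v \in Y).
Qed.
End Paths.

(** * Ladders and their matching automaton *)

Section Ladders.
Variable T : finType.
Implicit Types (x y : {set T}) (E M N S : {set {set T}}) (X Y : {set T}).
Implicit Types (a b c d v : T) (A B : seq T).

(* A chain is encoded by a rung {c, d}, an arbitrary edge of its first face, and
   for each face two paths, from [c] and from [d], without their starting points.
   The ends of the two paths form the next rung, which is the edge shared with
   the next face; one of the paths is empty when consecutive rungs meet. *)
Definition ladder := seq (seq T * seq T).
Implicit Types (F : seq T * seq T) (L : ladder).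

Fixpoint lverts L : seq T :=
  if L is F :: L' then F.1 ++ F.2 ++ lverts L' else [::].

Fixpoint ledges c d L : {set {set T}} :=
  if L is F :: L' then
    [set c; d] |: (path_edges c F.1 :|: (path_edges d F.2 :|:
       ledges (last c F.1) (last d F.2) L'))
  else [set [set c; d]].

(** The face has two more edges than the sum, namely its rungs. Positivity excludes the degenerate
    face whose two rungs coincide. *)
Definition even_face F := (~~ odd (size F.1 + size F.2)) && (0 < size F.1 + size F.2).

Definition wf_ladder c d L := uniq (c :: d :: lverts L) && all even_face L.

(* Both rungs of a face lie in a common perfect matching of it exactly when its
   sides have odd length; the two sides have the same parity. *)
Definition kinky F := odd (size F.1).

Lemma ledges_sub c d L x v :
  x \in ledges c d L -> v \in x -> v \in c :: d :: lverts L.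
Proof.
elim: L c d => [|[A B] L IH] c d /=; first by move/set1P->; rewrite !inE.
case/setU1P=> [->|]; first by rewrite !inE => /orP[]->; rewrite ?orbT.
rewrite !inE !mem_cat; case/or3P => [/path_edges_memP h|/path_edges_memP h|/IH h] /h.
- by rewrite inE; do 2!case: (_ \in _); rewrite ?orbT ?orbF // => ->; rewrite ?orbT.
- by rewrite inE; do 2!case: (_ \in _); rewrite ?orbT ?orbF // => ->; rewrite ?orbT.
rewrite !inE => /or3P[/eqP->|/eqP->|->]; last by rewrite !orbT.
  by have := mem_last c A; rewrite inE => /orP[]->; rewrite ?orbT.
by have := mem_last d B; rewrite inE => /orP[]->; rewrite ?orbT.
Qed.

Lemma rung_ledges c d L : [set c; d] \in ledges c d L.
Proof. by case: L => [|F L]; rewrite /= !inE eqxx. Qed.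

Lemma wf_consP c d A B L (c' := last c A) (d' := last d B) :
  wf_ladder c d ((A, B) :: L) ->
  [/\ [/\ uniq (c :: A), uniq (d :: B) & {in c :: A, forall v, v \notin d :: B}],
      {in c :: A, forall v, v \notin lverts L},
      {in d :: B, forall v, v \notin lverts L},
      wf_ladder c' d' L
    & odd (size B) = odd (size A) /\ 0 < size A + size B].
Proof.
case/andP => Uall /= /andP[/andP[/= eF posF] eL].
have /perm_uniq Uperm : perm_eq (c :: d :: A ++ B ++ lverts L) ((c :: A) ++ (d :: B) ++ lverts L).
  by rewrite /= perm_cons -cat1s perm_catCA.
move: Uall; rewrite -/(uniq (c :: d :: A ++ B ++ lverts L)) Uperm.
rewrite !cat_uniq => /and3P[UA HA /and3P[UB HB UL]].
move: HA HB; rewrite has_cat negb_or -!all_predC => /andP[/allP h1 /allP h2] /allP h3.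
have k1: {in c :: A, forall v, v \notin d :: B}.
  by move=> v vA; apply/negP => /h1; rewrite /= vA.
have k2: {in c :: A, forall v, v \notin lverts L}.
  by move=> v vA; apply/negP => /h2; rewrite /= vA.
have k3: {in d :: B, forall v, v \notin lverts L}.
  by move=> v vA; apply/negP => /h3; rewrite /= vA.
split=> //.
  rewrite /wf_ladder eL andbT /= UL (k3 _ (mem_last _ _)) inE negb_or.
  rewrite (k2 _ (mem_last _ _)) !andbT.
  by apply: contraNneq (k1 _ (mem_last c A)) => e; rewrite -/c' e mem_last.
split=> //; move: eF; rewrite oddD; by case: odd; case: odd.
Qed.

(* The ends of the first rung are either both covered or both left uncovered,
   the latter when they are matched to the left of that rung. *)
Definition cov c d L (p : bool) : {set T} :=
  [set v in (if p then [:: c; d] else [::]) ++ lverts L].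

Definition lmatch c d L p M := matches (ledges c d L) (cov c d L p) M.

Definition rung c d (p : bool) : {set {set T}} := if p then [set [set c; d]] else set0.

Lemma belast_last_notin c A v : uniq (c :: A) -> v \in belast c A -> v != last c A.
Proof.
by rewrite lastI rcons_uniq => /andP[h _]; apply: contraTneq => ->.
Qed.

Lemma wf_fresh1 c d A B L : wf_ladder c d ((A, B) :: L) ->
  fresh (belast c A) (path_edges d B :|: ledges (last c A) (last d B) L).
Proof.
case/wf_consP => -[UA UB dAB] dA dB _ _ v x vA; have vA' := mem_belast vA.
case/setUP => [xB|xL]; apply/negP => vx.
  by move: (path_edges_memP xB vx); apply/negP/dAB.
have := ledges_sub xL vx; rewrite !inE (negPf (belast_last_notin UA vA)) (negPf (dA _ vA')) orbF.
by move/eqP => ev; move: (dAB _ vA'); rewrite ev mem_last.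
Qed.

Lemma wf_fresh2 c d A B L : wf_ladder c d ((A, B) :: L) ->
  fresh (belast d B) (ledges (last c A) (last d B) L).
Proof.
case/wf_consP => -[UA UB dAB] dA dB _ _ v x vB xL; have vB' := mem_belast vB.
apply/negP => vx.
have := ledges_sub xL vx; rewrite !inE (negPf (belast_last_notin UB vB)) (negPf (dB _ vB')) !orbF.
by move/eqP => ev; move: (dAB _ (mem_last c A)); rewrite -ev vB'.
Qed.

Lemma wf_rung c d L F : wf_ladder c d (F :: L) ->
  [set c; d] \notin path_edges c F.1 :|: (path_edges d F.2 :|: ledges (last c F.1) (last d F.2) L).
Proof.
case: F => A B wf; have [[UA UB dAB] dA dB wfL [_ pos]] := wf_consP wf.
apply/negP => /setUP[xA|xBL].
  have := path_edges_memP xA (set22 c d) => /dAB; by rewrite mem_head.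
case: A wf UA dAB dA wfL pos xBL => [|a A] wf UA dAB dA wfL pos xBL; last first.
  by have := wf_fresh1 wf (mem_head _ _) xBL; rewrite set21.
case/setUP: xBL => [xB|xL].
  by have := path_edges_memP xB (set21 c d); apply/negP/dAB; rewrite mem_head.
case: B wf UB dAB dB wfL pos xL => //= b B wf _ _ _ _ _ xL.
by have := wf_fresh2 wf (mem_head _ _) xL; rewrite set22.
Qed.

(** The transition of the automaton: [r] says that the rung is used, [q] that its ends are matched
    to the right. The two sides have the same parity, so their last vertices make the same demand on
    the rest; this is why one boolean is enough for the state of a rung. *)
Lemma lmatch_cons c d F L p M (r := [set c; d] \in M) (q := p && ~~ r)
    (M' := M :&: ledges (last c F.1) (last d F.2) L) :
  wf_ladder c d (F :: L) -> lmatch c d (F :: L) p M ->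
  [/\ r ==> p,
      M = rung c d r :|: (alt_edges c F.1 q :|: (alt_edges d F.2 q :|: M'))
    & lmatch (last c F.1) (last d F.2) L (q (+) kinky F) M'].
Proof.
case: F @M' => A B M' wf pM; rewrite [(A, B).1]/= [(A, B).2]/= in M' *.
case: (wf_consP wf) => -[UA UB dAB] dA dB wfL [oddB _].
have rE := wf_rung wf; rewrite /= in rE.
have f1 := wf_fresh1 wf; have f2 := wf_fresh2 wf.
set E1 := path_edges d B :|: _ in f1 rE; set E2 := ledges _ _ L in E1 f1 f2 rE.
set E0 := path_edges c A :|: E1 in rE.
have [cNA cNB] : c \notin A /\ c \notin B.
  by split; [case/andP: UA | have := dAB c (mem_head _ _); rewrite inE negb_or => /andP[]].
have [dNA dNB] : d \notin A /\ d \notin B.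
  split; last by case/andP: UB.
  by apply/negP => dA'; have := dAB d; rewrite !inE dA' eqxx orbT => /(_ isT).
have cNL : c \notin lverts L by apply: dA; rewrite mem_head.
have dNL : d \notin lverts L by apply: dB; rewrite mem_head.
have cd : c != d by have := dAB c (mem_head _ _); rewrite inE negb_or => /andP[].
have [rp eM pM1] : [/\ r ==> p, M = rung c d r :|: (M :&: E0)
     & matches E0 (cov c d ((A,B) :: L) q) (M :&: E0)].
  have := matchesU1 rE pM; rewrite -/r /q; case: (r) => /=; last first.
    by case=> eM pM1; split=> //; rewrite ?set0U // andbT.
  case=> sX [eM pM1]; have -> /=: p.
    have := subsetP sX c (set21 _ _); rewrite !inE !mem_cat.
    by rewrite (negPf cNA) (negPf cNB) (negPf cNL) !orbF; case: (p).
  split=> //; congr (matches _ _ _): pM1.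
  apply/setP => v; rewrite !inE !mem_cat.
  have [->|vc] := eqVneq v c; first by rewrite (negPf cNA) (negPf cNB) (negPf cNL).
  have [->|vd] := eqVneq v d; first by rewrite (negPf dNA) (negPf dNB) (negPf dNL).
  by case: (p); rewrite ?inE ?(negPf vc) ?(negPf vd).
have X0: (c \in cov c d ((A, B) :: L) q) = q.
  by rewrite !inE !mem_cat (negPf cNA) (negPf cNB) (negPf cNL) !orbF; case: (q); rewrite ?inE ?eqxx.
have sA : {subset A <= cov c d ((A, B) :: L) q}.
  by move=> v vA; rewrite !inE !mem_cat vA !orbT.
have [] := matches_path UA f1 sA pM1.
rewrite X0; set X1 := _ :\: _ :|: _ => eM1 pM2.
have IE1 : M :&: E0 :&: E1 = M :&: E1.
  by rewrite -setIA; congr (_ :&: _); apply/setIidPr; apply: subsetUr.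
rewrite {}IE1 in eM1 pM2.
have kB v : v \in d :: B -> v \notin c :: A by move=> vB; apply/negP => /dAB; rewrite vB.
have dl : d == last c A = false.
  by apply/negbTE; apply: contraNneq (kB d (mem_head _ _)) => ->; rewrite mem_last.
have X2: (d \in X1) = q.
  rewrite !inE !mem_cat eq_sym (negPf cd) (negPf dNA) (negPf dNB) (negPf dNL) !orbF /=.
  by case: (q); case: odd; rewrite ?inE ?dl ?eqxx ?orbT.
have sB : {subset B <= X1}.
  move=> v vB; have := kB v; rewrite !inE !mem_cat vB !orbT => /(_ isT); rewrite negb_or => /andP[-> ->].
  by [].
have [] := matches_path UB f2 sB pM2.
rewrite X2 => eM2 pM3.
have IE2 : M :&: E1 :&: E2 = M'.
  by rewrite /M' -setIA; congr (_ :&: _); apply/setIidPr; apply: subsetUr.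
rewrite {}IE2 in eM2 pM3.
split=> //; first by rewrite {1}eM eM1 eM2.
congr (matches _ _ _): pM3; rewrite oddB /kinky /=.
have la := mem_last c A; have lb := mem_last d B.
apply/setP => v; rewrite !inE !mem_cat.
have hA := dA v; have hB := dB v; have hAB := dAB v.
rewrite !inE in hA hB hAB.
case: (boolP ((v == d) || (v \in B))) => vB /=.
  rewrite (negPf (hB vB)) !orbF /=.
  have vl: v == last c A = false.
    apply/negbTE; apply: contraTneq vB => ->; rewrite negb_or; have := dAB _ la.
    by rewrite inE negb_or.
  by case: (q (+) _); rewrite ?inE ?vl.
have vd: v == last d B = false.
  by apply/negbTE; apply: contraNneq vB => ->; rewrite -in_cons.
case: (boolP ((v == c) || (v \in A))) => vA /=.
  rewrite (negPf (hA vA)) ?orbF /=.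
  by case: (q (+) _); rewrite !inE ?vd ?orbF.
have vc: v == last c A = false.
  by apply/negbTE; apply: contraNneq vA => ->; rewrite -in_cons.
move: vA vB; rewrite !negb_or => /andP[/negPf vc' /negPf->] /andP[/negPf vd' /negPf->].
by case: (q); case: odd; rewrite ?inE ?vc ?vd ?vc' ?vd' ?orbF.
Qed.
End Ladders.

Section LadderMatchings.
Variable T : finType.
Implicit Types (x y : {set T}) (E M N S : {set {set T}}) (X Y : {set T}).
Implicit Types (a b c d v : T) (A B : seq T).
Implicit Types (F : seq T * seq T) (L : ladder T).

Lemma last_in_or c A : last c A \in A \/ A = [::].
Proof. by case: A => [|a A]; [right | left; rewrite /= mem_last]. Qed.

Lemma wf_disjoint c d A B L : wf_ladder c d ((A, B) :: L) ->
  [disjoint path_edges c A & ledges (last c A) (last d B) L] /\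
  [disjoint path_edges d B & ledges (last c A) (last d B) L].
Proof.
move=> wf; split.
  have := path_edges_fresh (wf_fresh1 wf); apply: disjointWr.
  by apply/subsetP => x; rewrite inE orbC => ->.
exact: path_edges_fresh (wf_fresh2 wf).
Qed.

(** The state is the only interaction between a face and the rest: a matching of the rest in the
    right state extends over the face. The lower bound uses this both to build matchings and to
    produce competitors of a given one. *)
Lemma lmatch_add c d F L p r M' (q := p && ~~ r) (E' := ledges (last c F.1) (last d F.2) L)
    (M := rung c d r :|: (alt_edges c F.1 q :|: (alt_edges d F.2 q :|: M'))) :
  wf_ladder c d (F :: L) -> r ==> p ->
  lmatch (last c F.1) (last d F.2) L (q (+) kinky F) M' ->
  [/\ lmatch c d (F :: L) p M, M :&: E' = M' & ([set c; d] \in M) = r].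
Proof.
case: F @E' @M => A B; rewrite [(A, B).1]/= [(A, B).2]/= => E' M wf rp pM'.
case: (wf_consP wf) => -[UA UB dAB] dA dB wfL [oddB pos].
have rE := wf_rung wf; rewrite /= in rE.
have [dE1 dE2] := wf_disjoint wf.
have sM' : M' \subset E' := matches_sub pM'.
have cd : c != d by have := dAB c (mem_head _ _); rewrite inE negb_or => /andP[].
have la := mem_last c A; have lb := mem_last d B.
have fB v : v \in d :: B -> v != last c A.
  by apply: contraTneq => ->; apply: dAB.
have fA v : v \in c :: A -> v != last d B.
  by move=> /dAB; apply: contraNneq => ->.
have ldB : (last d B \in cov (last c A) (last d B) L (q (+) kinky (A, B))) = q (+) odd (size B).
  rewrite oddB /kinky !inE mem_cat (negPf (dB _ lb)) orbF /=.
  by case: (q (+) _); rewrite // !inE eqxx orbT.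
have bB : {in belast d B, forall v, v \notin cov (last c A) (last d B) L (q (+) kinky (A, B))}.
  move=> v vB; have vB' := mem_belast vB.
  rewrite !inE mem_cat (negPf (dB _ vB')) orbF.
  by case: (q (+) _); rewrite // !inE (negPf (fB _ vB')) (negPf (belast_last_notin UB vB)).
have := matches_path_add UB bB ldB pM'; set Y1 := _ :|: _ :|: _ => pM1.
have nB v : v \in c :: A -> (v \in Y1) = (v \in cov (last c A) (last d B) L (q (+) kinky (A, B))).
  move=> vA; have := dAB v vA; rewrite !inE negb_or => /andP[/negPf vd /negPf ->].
  by rewrite orbF; case: (q); rewrite ?inE ?vd ?orbF.
have laY : (last c A \in Y1) = q (+) odd (size A).
  rewrite nB // !inE mem_cat (negPf (dA _ la)) orbF /kinky /=.
  by case: (q (+) _); rewrite // !inE eqxx.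
have bA : {in belast c A, forall v, v \notin Y1}.
  move=> v vA; have vA' := mem_belast vA.
  rewrite nB // !inE mem_cat (negPf (dA _ vA')) orbF.
  by case: (q (+) _); rewrite // !inE (negPf (fA _ vA')) (negPf (belast_last_notin UA vA)).
have := matches_path_add UA bA laY pM1; set Y2 := _ :|: _ :|: _ => pM2.
have eY2 : Y2 = cov c d ((A, B) :: L) q.
  apply/setP => v; rewrite !inE !mem_cat /kinky /=.
  have [hl|eA] := last_in_or c A; have [hl'|eB] := last_in_or d B.
  - case: (boolP (v \in A)) => vA; first by rewrite !orbT.
    have [vB|vB] := boolP (v \in B); first by rewrite ?orbT.
    have vl : v == last c A = false by apply: contraNF vA => /eqP->.
    have vl' : v == last d B = false by apply: contraNF vB => /eqP->.
    by case: (q); case: odd; rewrite ?inE ?vl ?vl' ?orbF //=;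
       case: (v == c); case: (v == d); case: (v \in lverts L).
  - rewrite eB /=; have -> : odd (size A) = false by rewrite -oddB eB.
    rewrite addbF; case: (boolP (v \in A)) => vA; first by rewrite !orbT.
    have vl : v == last c A = false by apply: contraNF vA => /eqP->.
    by case: (q); rewrite ?inE ?vl ?orbF //=;
       case: (v == c); case: (v == d); case: (v \in lverts L).
  - rewrite eA /= addbF; have [vB|vB] := boolP (v \in B); first by rewrite ?orbT.
    have vl' : v == last d B = false by apply: contraNF vB => /eqP->.
    by case: (q); rewrite ?inE ?vl' ?orbF //=;
       case: (v == c); case: (v == d); case: (v \in lverts L).
  by rewrite eA eB in pos.
have eM : M = rung c d r :|: (alt_edges c A q :|: (alt_edges d B q :|: M')) by [].
have rM : [set c; d] \notin alt_edges c A q :|: (alt_edges d B q :|: M').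
  apply: contra rE; rewrite !inE; case/or3P => h; apply/or3P.
  - by constructor 1; apply: subsetP h; apply: alt_edges_sub.
  - by constructor 2; apply: subsetP h; apply: alt_edges_sub.
  by constructor 3; apply: subsetP h.
have nr : [set c; d] \in E' = false.
  by apply: contraNF rE => rE'; rewrite !inE rE' !orbT.
split.
- rewrite /lmatch eM; move: eY2 pM2; rewrite /q; case: (r) rp => /=.
    move=> ->; rewrite andbF => -> pM2.
    have ad : [disjoint [set c; d] & cov c d ((A, B) :: L) false].
      apply/pred0P => v /=; rewrite !inE /= !mem_cat; apply/negP => /andP[] /orP[] /eqP-> /or3P[].
      + by case/andP: UA => /negPf->.
      + by have := dAB c (mem_head _ _); rewrite inE negb_or => /andP[_ /negPf->].
      + by rewrite (negPf (dA _ (mem_head _ _))).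
      + move=> h; have := dAB d; rewrite !inE h eqxx orbT; by move/(_ isT).
      + by case/andP: UB => /negPf->.
      by rewrite (negPf (dB _ (mem_head _ _))).
    have := matches_add ad pM2; congr (matches _ _ _).
    by apply/setP => v; rewrite !inE !mem_cat; case: (v == c); case: (v == d).
  move=> _; rewrite andbT set0U => -> pM3; apply: matches_weak (pM3).
  by apply: subset_trans (matches_sub pM3) _; apply: subsetUr.
- apply/setP => x; rewrite !inE; case: (boolP (x \in M')) => [xM|xM].
    by rewrite (subsetP sM' _ xM) !orbT.
  case: (boolP (x \in E')) => xE; rewrite ?andbF // andbT orbF.
  apply/negbTE; rewrite !negb_or; apply/and3P; split.
  + by case: (r); rewrite ?inE //; apply: contraTneq xE => ->; rewrite nr.
  + by apply/negP => /(subsetP (alt_edges_sub _ _ _)) h; rewrite (disjointFr dE1 h) in xE.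
  + by apply/negP => /(subsetP (alt_edges_sub _ _ _)) h; rewrite (disjointFr dE2 h) in xE.
rewrite eM in_setU (negPf rM) orbF; by case: (r); rewrite !inE ?eqxx.
Qed.

Lemma lmatch_nil c d p M : c != d -> lmatch c d [::] p M <-> M = rung c d p.
Proof.
move=> cd; split.
  move=> pM; have := pM; rewrite /lmatch /= -(setU0 [set [set c; d]]).
  move/(matchesU1 (negbT (in_set0 _))).
  have emp : M :&: set0 = set0 by rewrite setI0.
  rewrite emp; case: ifP => xM.
    case=> sX [-> _]; rewrite setU0; case: p sX {pM} => // /subsetP/(_ c).
    by rewrite !inE eqxx => /(_ isT).
  case=> -> _; case: p pM => // pM.
  have [|y yM _] := matches_ex (v := c) pM; first by rewrite !inE eqxx.
  by move: xM; have := subsetP (matches_sub pM) _ yM; rewrite inE => /eqP <-; rewrite yM.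
move->; apply/matchesP; case: p => /=; split; rewrite ?sub0set //.
  move=> v; rewrite -[[set _]]setU0 cover_numU1 ?inE //.
  have -> : cover_num set0 v = 0 by apply: eq_card0 => y; rewrite !inE.
  by rewrite addn0.
by move=> v; rewrite !inE; apply: eq_card0 => y; rewrite !inE.
Qed.

Lemma wf_neq c d L : wf_ladder c d L -> c != d.
Proof. by case/andP => /= /andP[+ _]; rewrite inE negb_or => /andP[]. Qed.

Lemma lmatch_unrung c d L M : wf_ladder c d L -> [set c; d] \in M -> lmatch c d L true M ->
  lmatch c d L false (M :\ [set c; d]).
Proof.
move=> wf xM pM; have := matches_rem xM pM; congr (matches _ _ _).
apply/setP => v; rewrite !inE; case/andP: wf => /= /and3P[]; rewrite inE negb_or => /andP[_ cL] dL _ _.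
have [->|_] := eqVneq v c; first by rewrite (negPf cL).
by have [->|_] := eqVneq v d; rewrite ?(negPf dL).
Qed.

Lemma lmatch_rung c d L M : wf_ladder c d L -> lmatch c d L false M ->
  lmatch c d L true ([set c; d] |: M).
Proof.
move=> wf pM; case/andP: wf => /= /and3P[]; rewrite inE negb_or => /andP[_ cL] dL _ _.
have ad : [disjoint [set c; d] & cov c d L false].
  apply/pred0P => v /=; rewrite !inE; apply/negP => /andP[/orP[]/eqP->]; first exact/negP.
  exact/negP.
have := matches_add ad pM.
have -> : [set c; d] |: ledges c d L = ledges c d L by apply/setUidPr; rewrite sub1set rung_ledges.
congr (matches _ _ _); apply/setP => v; rewrite !inE; by case: (v == c); case: (v == d).
Qed.

Lemma lmatch_norung c d L M : wf_ladder c d L -> lmatch c d L false M -> [set c; d] \notin M.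
Proof.
move=> wf pM; case/andP: wf => /= /and3P[]; rewrite inE negb_or => /andP[_ cL] dL _ _.
by apply/negP => xM; have := matches_mem pM xM (set21 _ _); rewrite inE /= (negPf cL).
Qed.

End LadderMatchings.

(** * The anti-forcing number of a ladder *)

Section Bounds.
Variable T : finType.
Implicit Types (x y e : {set T}) (E M N S : {set {set T}}) (X Y : {set T}).
Implicit Types (a b c d v : T) (A B : seq T).
Implicit Types (F : seq T * seq T) (L : ladder T).

(* The triple counts alternating faces of a best matching of the ladder: [g] when
   it is perfect; [h] when it leaves the first rung uncovered; [t] when it contains
   the first rung, the other side of which is then a further alternating face. *)
Fixpoint bounds L : nat * nat * nat :=
  if L is F :: L' then
    let: (g, t, h) := bounds L' in
    (t.+1, (if kinky F then t else h).+1, if kinky F then g else h)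
  else (0, 0, 0).

Definition gnum L := (bounds L).1.1.
Definition tnum L := (bounds L).1.2.
Definition hnum L := (bounds L).2.

Lemma gnum_cons F L : gnum (F :: L) = (tnum L).+1.
Proof. by rewrite /gnum /tnum /=; case: (bounds L) => [[g t] h]. Qed.

Lemma tnum_cons F L : tnum (F :: L) = (if kinky F then tnum L else hnum L).+1.
Proof. by rewrite /hnum /tnum /=; case: (bounds L) => [[g t] h]. Qed.

Lemma hnum_cons F L : hnum (F :: L) = if kinky F then gnum L else hnum L.
Proof. by rewrite /hnum /gnum /=; case: (bounds L) => [[g t] h]. Qed.

Lemma bounds_le L :
  [/\ hnum L <= tnum L, tnum L <= gnum L, gnum L <= (tnum L).+1 & tnum L <= (hnum L).+1].
Proof.
elim: L => [|F L [h1 h2 h3 h4]]; first by rewrite /gnum /tnum /hnum.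
by rewrite gnum_cons tnum_cons hnum_cons; case: kinky; split; lia.
Qed.

(** A normalization of the encoding, available because the last right rung is an arbitrary edge. The
    default [true] lets it pass to the empty tail. *)
Definition last_kinky L := last true (map (@kinky T) L).

Lemma last_kinky_cons F L : last_kinky (F :: L) -> last_kinky L.
Proof. by case: L. Qed.

(** [P] describes what is known of the left: [pred1 p] when the state of the first rung is settled,
    [predT] when nothing is known. In the second case [S] must also exclude every matching in the
    state opposite to that of [M]. *)
Definition forcible c d L (P : pred bool) M n := exists S,
  [/\ S \subset ledges c d L, [disjoint M & S], #|S| <= n
    & forall p N, P p -> lmatch c d L p N -> [disjoint N & S] -> N = M].

(* The ends of the rung are covered, by edges other than the rung itself. *)
Definition turn c d p M := p && ([set c; d] \notin M).

Definition tail_part c d F L M := M :&: ledges (last c F.1) (last d F.2) L.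

Lemma ledges_tail c d F L : ledges (last c F.1) (last d F.2) L \subset ledges c d (F :: L).
Proof. by apply/subsetP => x /= xL; rewrite !inE xL !orbT. Qed.

Lemma disjointU_sets (A B C : {set {set T}}) :
  [disjoint A :|: B & C] = [disjoint A & C] && [disjoint B & C].
Proof. by rewrite -!setI_eq0 setIUl setU_eq0. Qed.

Lemma lmatch_cov c d L p p' M : wf_ladder c d L ->
  lmatch c d L p M -> lmatch c d L p' M -> p = p'.
Proof.
move=> wf /matchesP[_ cM] /matchesP[_ cM'].
have := cM c; rewrite cM'; case/andP: wf => /= /andP[+ _] _.
rewrite !inE negb_or => /andP[_ cL].
by case: (p); case: (p'); rewrite /= ?inE ?eqxx ?(negPf cL).
Qed.

(** [S0] is the expense for the first face. It has to confine the state of the next rung to [P'] and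
    to make a matching recoverable from its tail; the deletions in the tail do the rest. *)
Lemma forcible_cons c d F L (P P' : pred bool) M S0 k n :
  S0 \subset ledges c d (F :: L) -> [disjoint M & S0] -> #|S0| <= k ->
  forcible (last c F.1) (last d F.2) L P' (tail_part c d F L M) n ->
  (forall p N, P p -> lmatch c d (F :: L) p N -> [disjoint N & S0] ->
     P' (turn c d p N (+) kinky F) /\ (tail_part c d F L N = tail_part c d F L M -> N = M)) ->
  wf_ladder c d (F :: L) ->
  forcible c d (F :: L) P M (k + n).
Proof.
move=> sS0 dS0 lk [S [sS dS ln fS]] kill wf; exists (S0 :|: S); split.
- by rewrite subUset sS0; apply: subset_trans sS (ledges_tail _ _ _ _).
- rewrite disjoint_sym disjointU_sets disjoint_sym dS0 /=.
  rewrite disjoints_subset; apply/subsetP => x xS; rewrite inE; apply/negP => xM.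
  by move: (disjointFl dS xS); rewrite inE xM (subsetP sS _ xS).
- by apply: leq_trans (leq_add lk ln); rewrite cardsU leq_subr.
move=> p N Pp pN dN.
have dN0 : [disjoint N & S0] by apply: disjointWr dN; apply: subsetUl.
have [P'p eN] := kill p N Pp pN dN0; apply: eN.
have [_ _ pN'] := lmatch_cons wf pN.
apply: (fS _ _ P'p pN'); apply: disjointWl (subsetIl _ _) _.
by apply: disjointWr dN; apply: subsetUr.
Qed.

Lemma lmatch_same c d F L p M N : wf_ladder c d (F :: L) ->
  lmatch c d (F :: L) p M -> lmatch c d (F :: L) p N ->
  ([set c; d] \in N) = ([set c; d] \in M) ->
  tail_part c d F L N = tail_part c d F L M -> N = M.
Proof.
move=> wf pM pN eR eT; have [_ -> _] := lmatch_cons wf pM.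
by have [_ -> _] := lmatch_cons wf pN; rewrite -/(tail_part c d F L N) -/(tail_part c d F L M) eR eT.
Qed.

(** One of the sides may be empty, so the edge starts at [c] or at [d]. In both cases it competes
    with the rung, and every matching that covers the rung from the right contains it. *)
Lemma first_edge c d F L : wf_ladder c d (F :: L) ->
  exists e, [/\ e \in ledges c d (F :: L), e != [set c; d], (c \in e) || (d \in e)
    & forall p N, lmatch c d (F :: L) p N -> turn c d p N -> e \in N].
Proof.
case: F => A B wf; case: (wf_consP wf) => -[UA UB dAB] dA dB wfL [oddB pos].
case: A => [|a A] in wf UA dAB dA wfL oddB pos *.
  case: B wf UB dAB dB wfL oddB pos => //= b B wf UB dAB dB wfL oddB pos.
  exists [set d; b]; split; rewrite ?inE ?eqxx ?orbT //.
    apply: contraNneq (dAB c (mem_head _ _)) => e.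
    by have := set21 c d; rewrite -e !inE => /orP[]/eqP->; rewrite eqxx ?orbT.
  move=> p N pN; rewrite /turn => q; have [_ -> _] := lmatch_cons wf pN.
  by rewrite q /= !inE eqxx !orbT.
exists [set c; a]; split; rewrite /= ?inE ?eqxx ?orbT //.
  apply: contraTneq (set22 c d) => <-; rewrite !inE negb_or.
  have := dAB c (mem_head _ _); rewrite inE negb_or eq_sym => /andP[-> _] /=.
  have := dAB a; rewrite !inE eqxx orbT => /(_ isT); rewrite negb_or eq_sym => /andP[-> _].
  by [].
move=> p N pN; rewrite /turn => q; have [_ -> _] := lmatch_cons wf pN.
by rewrite q /= !inE eqxx !orbT.
Qed.

(** The sides of a non-kink are even and not both empty, so one of them has at least two edges.
    Deleting the second one forces the rung to be matched to the right, even if nothing is known of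
    its left state. *)
Lemma second_edge c d F L : wf_ladder c d (F :: L) -> ~~ kinky F ->
  exists2 e, e \in ledges c d (F :: L) &
    forall p N, lmatch c d (F :: L) p N -> (e \in N) = ~~ turn c d p N.
Proof.
case: F => A B wf; case: (wf_consP wf) => -[UA UB dAB] dA dB wfL [oddB pos].
rewrite /kinky /= => kF; rewrite (negPf kF) in oddB.
case: A => [|a [|a' A]] // in wf UA dAB dA wfL oddB pos kF *.
  case: B wf UB dAB dB wfL oddB pos => [|b [|b' B]] //= wf UB dAB dB wfL oddB pos.
  exists [set b; b']; first by rewrite !inE eqxx !orbT.
  move=> p N pN; have [_ eN _] := lmatch_cons wf pN; rewrite -/(turn c d p N) in eN.
  case: (boolP (turn c d p N)) eN => _ eN /=; last by rewrite eN !inE eqxx !orbT.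
  apply/negP => hN; have hN' : [set d; b] \in N by rewrite eN !inE eqxx !orbT.
  have e := matches_inj pN hN' hN (set22 _ _) (set21 _ _).
  move: UB; have := set21 d b; rewrite e !inE => /orP[]/eqP->; by rewrite ?eqxx ?orbT.
exists [set a; a']; first by rewrite /= !inE eqxx !orbT.
move=> p N pN; have [_ eN _] := lmatch_cons wf pN; rewrite -/(turn c d p N) in eN.
case: (boolP (turn c d p N)) eN => _ eN /=; last by rewrite eN /= !inE eqxx !orbT.
apply/negP => hN; have hN' : [set c; a] \in N by rewrite eN /= !inE eqxx !orbT.
have e := matches_inj pN hN' hN (set22 _ _) (set21 _ _).
move: UA; have := set21 c a; rewrite e !inE => /orP[]/eqP->; by rewrite /= !inE ?eqxx ?orbT.
Qed.

(** If [M] avoids the rung, the rung itself is deleted; if [M] uses it, the first edge of a side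
    is. *)
Lemma kill_first c d F L M : wf_ladder c d (F :: L) -> lmatch c d (F :: L) true M ->
  exists e, [/\ e \in ledges c d (F :: L), e \notin M &
    forall N, lmatch c d (F :: L) true N -> e \notin N ->
       ([set c; d] \in N) = ([set c; d] \in M)].
Proof.
move=> wf pM; case: (boolP ([set c; d] \in M)) => rM; last first.
  by exists [set c; d]; split=> //; [apply: rung_ledges | move=> N _ /negbTE].
have [e [eE er cde eN]] := first_edge wf; exists e; split=> //.
  apply/negP => eM; move: er; case/orP: cde => cde.
    by rewrite (matches_inj pM eM rM cde (set21 _ _)) eqxx.
  by rewrite (matches_inj pM eM rM cde (set22 _ _)) eqxx.
move=> N pN; apply: contraNT; rewrite -[_ \notin _]/(turn c d true N); exact: eN.
Qed.

Lemma disjoint1s (A : {set {set T}}) x : [disjoint A & [set x]] = (x \notin A).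
Proof. by rewrite disjoint_sym disjoints1. Qed.

Lemma forcible_first c d F L M n : wf_ladder c d (F :: L) -> lmatch c d (F :: L) true M ->
  forcible (last c F.1) (last d F.2) L (pred1 (turn c d true M (+) kinky F)) (tail_part c d F L M) n ->
  forcible c d (F :: L) (pred1 true) M n.+1.
Proof.
move=> wf pM fL; have [e [eE eM eN]] := kill_first wf pM.
have := @forcible_cons c d F L (pred1 true) _ M [set e] 1 n _ _ _ fL; rewrite add1n.
apply=> //; rewrite ?sub1set ?disjoint1s ?cards1 //.
move=> p N /eqP-> pN; rewrite disjoint1s => /(eN _ pN) eR; split.
  by rewrite /= /turn eR.
exact: (lmatch_same wf pM pN eR).
Qed.

Lemma forcible_le c d L (P : pred bool) M n m : n <= m -> forcible c d L P M n -> forcible c d L P M m.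
Proof. by move=> nm [S [? ? ln ?]]; exists S; split=> //; apply: leq_trans nm. Qed.

Lemma forcible_nil c d p : c != d -> forcible c d [::] (pred1 p) (rung c d p) 0.
Proof.
move=> cd; exists set0; split; rewrite ?sub0set ?cards0 //.
  by rewrite -setI_eq0 setI0.
by move=> q N /eqP-> /(lmatch_nil _ _ cd).
Qed.

Lemma tail_match c d F L p M : wf_ladder c d (F :: L) -> lmatch c d (F :: L) p M ->
  lmatch (last c F.1) (last d F.2) L (turn c d p M (+) kinky F) (tail_part c d F L M).
Proof. by move=> wf pM; have [] := lmatch_cons wf pM. Qed.

Lemma wf_tail c d F L : wf_ladder c d (F :: L) -> wf_ladder (last c F.1) (last d F.2) L.
Proof. by case: F => A B wf; case: (wf_consP wf). Qed.

(** The first face is free of charge. The tail is determined in every state, so the state of the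
    next rung is known, and with it whether the first rung is matched to the right. If it is not, a
    used rung and uncovered ends have the same tail; the condition on [P] removes this ambiguity. *)
Lemma forcible_both c d F L (P : pred bool) M n : wf_ladder c d (F :: L) ->
  lmatch c d (F :: L) true M -> (forall p, P p -> [set c; d] \in M -> p) ->
  forcible (last c F.1) (last d F.2) L predT (tail_part c d F L M) n ->
  forcible c d (F :: L) P M n.
Proof.
move=> wf pM rM fL.
have d0 : [disjoint M & set0] by rewrite -setI_eq0 setI0.
apply: (@forcible_cons c d F L P predT M set0 0 n (sub0set _) d0 _ fL _ wf).
  by rewrite cards0.
move=> p N /rM {}rM pN _; split=> // eT.
have := tail_match wf pN; rewrite eT => /(lmatch_cov (wf_tail wf))/(_ (tail_match wf pM)).
move/addIb; rewrite /turn /= => e.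
have ep : p by case: (boolP (_ \in M)) rM e => [_ ->|_ _ /andP[]].
rewrite ep in pN e; apply: (lmatch_same wf pM pN) => //.
by move: e; case: (_ \in N); case: (_ \in M).
Qed.

(* In the third claim the previous face ends at an unused rung covered from the
   right. Either the rest of the ladder can be forced whatever happens to the left
   of the rung, or one deletion is saved, to be spent on the previous face. *)
Lemma upper_bounds L c d M : wf_ladder c d L -> last_kinky L ->
  [/\ lmatch c d L true M -> forcible c d L (pred1 true) M (gnum L),
      lmatch c d L false M -> forcible c d L (pred1 false) M (hnum L)
    & lmatch c d L true M -> [set c; d] \notin M ->
      forcible c d L predT M (hnum L).+2 \/ forcible c d L (pred1 true) M (hnum L).+1].
Proof.
(* Strong induction, since [IH2] applies the hypothesis two faces further on. *)
have [n] := ubnP (size L); elim: n L c d M => // n IH [|F L] c d M /= sL wf lK.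
  have cd := wf_neq wf; split=> [/(lmatch_nil _ _ cd)->|/(lmatch_nil _ _ cd)->|].
  - exact: forcible_nil.
  - exact: forcible_nil.
  by move/(lmatch_nil _ _ cd)->; rewrite /= set11.
have wfL := wf_tail wf; have lKL := last_kinky_cons lK.
have [ht tg gt th] := bounds_le L.
have IHp p N : lmatch (last c F.1) (last d F.2) L p N ->
    forcible (last c F.1) (last d F.2) L (pred1 p) N (if p then gnum L else hnum L).
  by case: p; case: (IH L _ _ N sL wfL lKL).
(* If the next rung is used, one deletion settles the face behind it, and the remainder costs
   exactly the [hnum] of the tail, for a kink as for a non-kink. *)
have IH2 N : ~~ [disjoint [set [set last c F.1; last d F.2]] & N] ->
    lmatch (last c F.1) (last d F.2) L true N ->
    0 < size L -> forcible (last c F.1) (last d F.2) L (pred1 true) N (hnum L).+1.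
  case: L sL wf wfL lKL {ht tg gt th IHp lK} => // F2 L sL wf wfL lKL.
  rewrite disjoints1 negbK => rN pN _.
  have pN' := tail_match wfL pN.
  have [f1 f2 _] := IH L _ _ (tail_part (last c F.1) (last d F.2) F2 L N) (ltnW sL) (wf_tail wfL) (last_kinky_cons lKL).
  apply: (forcible_first wfL pN); rewrite hnum_cons.
  by move: pN'; rewrite /turn rN /=; case: (kinky F2).
have tM := tail_match wf; split=> pM.
- have {}tM := tM _ _ pM; rewrite gnum_cons.
  (* One deletion for the first face is affordable unless the tail costs [gnum L], which then
     exceeds [tnum L]. In that case [L] starts with a non-kink and [(hnum L).+1 = tnum L], so either
     [IH2] saves a deletion in the tail, or the third claim saves one in the tail or in the first
     face. *)
  have [le|lt] := leqP (if turn c d true M (+) kinky F then gnum L else hnum L) (tnum L).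
    by apply: forcible_le (forcible_first wf pM (IHp _ _ tM)); rewrite ltnS.
  have e : turn c d true M (+) kinky F by case: ifP lt => //; lia.
  rewrite e in tM lt; have sL0 : 0 < size L by case: (L) lt.
  have nt : (hnum L).+1 = tnum L.
    by case: (L) lt => [|F2 L2] //; rewrite gnum_cons tnum_cons hnum_cons; case: ifP; rewrite ?ltnn.
  have f1 n' : forcible (last c F.1) (last d F.2) L (pred1 true) (tail_part c d F L M) n' ->
      forcible c d (F :: L) (pred1 true) M n'.+1.
    by move=> f; apply: (forcible_first wf pM); rewrite e.
  case: (boolP ([set last c F.1; last d F.2] \in tail_part c d F L M)) => rM'.
    by apply: f1; rewrite -nt; apply: IH2; rewrite // disjoints1 rM'.
  have [_ _ /(_ tM rM')[f2|f2]] := IH L _ _ (tail_part c d F L M) sL wfL lKL; last first.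
    by apply: f1; rewrite -nt.
  by rewrite -nt; apply: (forcible_both wf pM) f2 => p /eqP.
- rewrite hnum_cons; have {}tM := tM _ _ pM.
  have d0 : [disjoint M & set0] by rewrite -setI_eq0 setI0.
  have := IHp _ _ tM; rewrite /turn /= => fL.
  apply: (@forcible_cons c d F L (pred1 false) _ M set0 0 _ (sub0set _) d0 _ fL _ wf).
    by rewrite cards0.
  move=> p N /eqP-> pN _; rewrite /turn /= eqxx; split=> //; apply: (lmatch_same wf pM pN).
  have [+ _ _] := lmatch_cons wf pM; have [+ _ _] := lmatch_cons wf pN.
  by case: (_ \in N); case: (_ \in M).
move=> rM; rewrite hnum_cons; have {}tM := tM _ _ pM.
have tr : turn c d true M by [].
rewrite tr /= in tM; case: (boolP (kinky F)) => kF; rewrite kF /= in tM.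
  right; apply: forcible_le (forcible_first wf pM (n := hnum L) _); first by rewrite ltnS; lia.
  by rewrite tr kF; apply: IHp tM.
(* The normalization of the last face provides a face to the right of a non-kink. *)
have sL0 : 0 < size L by move: lK; rewrite /last_kinky /=; case: (L) => //=; rewrite (negPf kF).
left; have [e eE eN] := second_edge wf kF.
have f1 m : forcible (last c F.1) (last d F.2) L (pred1 true) (tail_part c d F L M) m ->
    forcible c d (F :: L) predT M m.+1.
  move=> f; rewrite -add1n; apply: (forcible_cons (S0 := [set e]) _ _ _ f _ wf).
  - by rewrite sub1set.
  - by rewrite disjoint1s (eN _ _ pM) tr.
  - by rewrite cards1.
  move=> p N _ pN; rewrite disjoint1s (eN _ _ pN) negbK => tN; rewrite tN (negPf kF).
  split=> //; have /andP[ep rN] := tN; rewrite ep in pN.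
  by apply: (lmatch_same wf pM pN); rewrite (negPf rM) (negPf rN).
case: (boolP ([set last c F.1; last d F.2] \in tail_part c d F L M)) => rM'.
  by apply: f1; apply: IH2; rewrite // disjoints1 rM'.
have [_ _ /(_ tM rM')[f2|f2]] := IH L _ _ (tail_part c d F L M) sL wfL lKL; last by apply: f1.
by apply: (forcible_both wf pM) f2 => p _; rewrite (negPf rM).
Qed.

End Bounds.

(** * Lower bound: matchings with many independent alternating faces *)

Section Lower.
Variable T : finType.
Implicit Types (x y e : {set T}) (E M N S : {set {set T}}) (X Y : {set T}).
Implicit Types (a b c d v : T) (A B : seq T).
Implicit Types (F : seq T * seq T) (L : ladder T).

Definition needs c d L p M n := forall S, [disjoint M & S] ->
  (forall N, lmatch c d L p N -> [disjoint N & S] -> N = M) -> n <= #|S|.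

(** A competitor of [M'] in the tail, extended by the part of [M] in the first face, is a competitor
    of [M]: the added edges belong to [M] and so avoid [S]. *)
Lemma forcing_tail c d F L p r M M' N S : wf_ladder c d (F :: L) ->
  lmatch c d (F :: L) p M -> ([set c; d] \in M) = r -> tail_part c d F L M = M' ->
  [disjoint M & S] ->
  (forall N, lmatch c d (F :: L) p N -> [disjoint N & S] -> N = M) ->
  lmatch (last c F.1) (last d F.2) L ((p && ~~ r) (+) kinky F) N ->
  [disjoint N & S :&: ledges (last c F.1) (last d F.2) L] -> N = M'.
Proof.
move=> wf pM rM tM dM uM pN dN; have [rp eM _] := lmatch_cons wf pM.
rewrite rM in rp eM; have [pN1 tN rN] := lmatch_add wf rp pN.
set N1 := _ :|: _ in pN1 tN rN.
suff eN : N1 = M by rewrite -tM -eN.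
apply: uM pN1 _; rewrite disjoints_subset; apply/subsetP => x xN; rewrite inE.
have [xM|xM] := boolP (x \in M); first by rewrite (disjointFr dM xM).
have xN' : x \in N.
  move: xN xM; rewrite {}eM /N1 !inE => /or4P[]->; rewrite ?orbT //.
have xE := subsetP (matches_sub pN) _ xN'.
by have := disjointFr dN xN'; rewrite inE xE andbT => ->.
Qed.

Lemma needs_tail c d F L p r M' n : wf_ladder c d (F :: L) -> r ==> p ->
  lmatch (last c F.1) (last d F.2) L ((p && ~~ r) (+) kinky F) M' ->
  needs (last c F.1) (last d F.2) L ((p && ~~ r) (+) kinky F) M' n ->
  exists M, lmatch c d (F :: L) p M /\ needs c d (F :: L) p M n.
Proof.
move=> wf rp pM' nM'; have [pM tM rM] := lmatch_add wf rp pM'.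
set M := _ :|: _ in pM tM rM; exists M; split=> // S dM uM.
apply: leq_trans (subset_leq_card (subsetIl S (ledges (last c F.1) (last d F.2) L))).
apply: nM' => [|N pN dN].
  have sM : M' \subset M by rewrite /M; do !apply: subset_trans (subsetUr _ _).
  apply: disjointWl sM _; exact: disjointWr (subsetIl _ _) dM.
exact: (forcing_tail wf pM rM tM dM uM pN dN).
Qed.

(* Switching the first face, which is alternating for [M], costs one more deletion. *)
Lemma needs_flip c d F L r M' n : wf_ladder c d (F :: L) ->
  lmatch (last c F.1) (last d F.2) L (~~ r (+) kinky F) M' ->
  (~~ r (+) kinky F -> [set last c F.1; last d F.2] \in M') ->
  needs (last c F.1) (last d F.2) L (~~ r (+) kinky F) M' n ->
  exists M, [/\ lmatch c d (F :: L) true M, ([set c; d] \in M) = r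
    & needs c d (F :: L) true M n.+1].
Proof.
move=> wf pM' rM' nM'; have wfL := wf_tail wf.
have rp : r ==> true by case: (r).
have [pM tM rM] := lmatch_add wf rp pM'.
set M := _ :|: _ in pM tM rM; exists M; split=> // S dM uM.
set x' := [set last c F.1; last d F.2] in rM'.
(* Seen from the tail, switching the first face merely removes or inserts the next rung. *)
have [N' [pN' sN']] : exists N', lmatch (last c F.1) (last d F.2) L (true && ~~ ~~ r (+) kinky F) N' /\
    N' \subset x' |: M'.
  have -> : (true && ~~ ~~ r) (+) kinky F = ~~ (~~ r (+) kinky F) by case: (r); case: kinky.
  case: (boolP (~~ r (+) kinky F)) rM' pM' => /= cov rM' pM'.
    exists (M' :\ x'); split; first by apply: lmatch_unrung; rewrite // rM'.
    by apply: subset_trans (subsetDl _ _) (subsetUr _ _).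
  by exists (x' |: M'); split; first apply: lmatch_rung.
have rp' : ~~ r ==> true by case: (r).
have [pN tN rN] := lmatch_add wf rp' pN'.
set N := _ :|: _ in pN tN rN.
have [e eN eS] : exists2 e, e \in N & e \in S.
  apply/exists_inP; apply: contraT => h; have dN : [disjoint N & S].
    rewrite disjoints_subset; apply/subsetP => x xN; rewrite inE; apply/negP => xS.
    by case/negP: h; apply/exists_inP; exists x.
  by move: rN; rewrite (uM N pN dN) rM; case: (r).
have eM : e \notin M by apply/negP => eM; rewrite (disjointFr dM eM) in eS.
(* The next rung is discarded because it may be the edge [e] charged to the first face. The tail
   stays forced without it: either [x'] is in [M] and so not in [S], or the state of the tail keeps
   every matching from using [x']. *)
pose S' := (S :&: ledges (last c F.1) (last d F.2) L) :\ x'.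
have eS' : e \notin S'.
  apply/negP; rewrite !inE => /and3P[ex _ eE].
  have : e \in N' by rewrite -tN inE eN eE.
  move/(subsetP sN'); rewrite !inE (negPf ex) /= -tM inE => /andP[eM' _].
  by rewrite eM' in eM.
have sS' : S' \subset S by apply: subset_trans (subsetDl _ _) (subsetIl _ _).
have: S' \proper S by apply/properP; split=> //; exists e.
move/proper_card; apply: leq_trans; rewrite ltnS; apply: nM' => [|N2 pN2 dN2].
  have sM : M' \subset M by rewrite /M; do !apply: subset_trans (subsetUr _ _).
  apply: disjointWl sM _; exact: disjointWr dM.
apply: (forcing_tail wf pM rM tM dM uM pN2).
rewrite disjoints_subset; apply/subsetP => y yN2; rewrite inE; apply/negP => yS.
have /eqP eyx : y == x'.
  by have := disjointFr dN2 yN2; rewrite in_setD1 yS andbT => /negbFE.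
move: yS; rewrite eyx inE => /andP[xS xE].
case: (boolP (~~ r (+) kinky F)) rM' pN2 => [_ /(_ isT)|] xM' pN2.
  have : x' \in M by rewrite /M !inE xM' !orbT.
  by move=> xM; rewrite (disjointFr dM xM) in xS.
by move=> pN3; have := lmatch_norung wfL pN3; rewrite -/x' -eyx yN2.
Qed.

(** The origin of the recursion [bounds]. For the second claim the first rung is used exactly when
    the face is a kink: then the next rung is open to choice, it is used, and the first face
    alternates whatever its kind. When the first rung is left uncovered no face is gained, and the
    tail is perfect or uncovered according to the kind of the face. *)
Lemma lower_bounds L c d : wf_ladder c d L ->
  [/\ exists M, [/\ lmatch c d L true M, [set c; d] \in M & needs c d L true M (tnum L)],
      exists M, lmatch c d L true M /\ needs c d L true M (gnum L)
    & exists M, lmatch c d L false M /\ needs c d L false M (hnum L)].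
Proof.
elim: L c d => [|F L IH] c d wf.
  have cd := wf_neq wf; split; [exists (rung c d true)|exists (rung c d true)|exists (rung c d false)];
    by split=> //; try (by apply/lmatch_nil); rewrite /= inE.
have [[M1 [p1 r1 n1]] [M2 [p2 n2]] [M3 [p3 n3]]] := IH _ _ (wf_tail wf).
rewrite gnum_cons tnum_cons hnum_cons; split.
- case: (boolP (kinky F)) => kF.
    have := @needs_flip c d F L true M1 (tnum L) wf; rewrite kF /= => /(_ p1 (fun=> r1) n1).
    by case=> M [? ? ?]; exists M; split.
  have := @needs_flip c d F L true M3 (hnum L) wf; rewrite (negPf kF) /= => /(_ p3 _ n3)[] //.
  by move=> M [? ? ?]; exists M; split.
- have := @needs_flip c d F L (kinky F) M1 (tnum L) wf; rewrite addNb addbb /= => /(_ p1 (fun=> r1) n1).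
  by case=> M [? ? ?]; exists M; split.
have := @needs_tail c d F L false false; case: (kinky F) => /= h; first exact: (h _ _ wf isT p2 n2).
exact: (h _ _ wf isT p3 n3).
Qed.

End Lower.

(** * The maximum anti-forcing number of a ladder *)

Section LadderGraph.
Variable T : finType.
Implicit Types (x y e : {set T}) (E M N S : {set {set T}}) (X Y : {set T}).
Implicit Types (a b c d v : T) (A B : seq T).
Implicit Types (F : seq T * seq T) (L : ladder T) (H K : graph T).

Definition lgraph c d L : graph T := ([set v in c :: d :: lverts L], ledges c d L).

Lemma perfect_matchingE H M : {in eset H, forall x, x \subset vset H} ->
  perfect_matching H M = matches (eset H) (vset H) M.
Proof.
move=> sH; apply/andP/andP => -[sM /forallP cM]; split=> //; apply/forallP => v; last first.
  by apply/implyP => vH; have := cM v; rewrite vH.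
case: (boolP (v \in vset H)) => vH; first by have := cM v; rewrite vH.
rewrite cards_eq0 -subset0; apply/subsetP => x; rewrite inE => /andP[xM vx].
by case/negP: vH; apply: subsetP vx; apply: sH (subsetP sM _ xM).
Qed.

Lemma eset_lgraph c d L : {in eset (lgraph c d L), forall x, x \subset vset (lgraph c d L)}.
Proof. by move=> x xL; apply/subsetP => v vx; rewrite inE (ledges_sub xL vx). Qed.

Lemma lgraph_pm c d L M : perfect_matching (lgraph c d L) M = lmatch c d L true M.
Proof. exact: perfect_matchingE (@eset_lgraph c d L). Qed.

Lemma del_edges_pm H M S :
  perfect_matching (del_edges H S) M = perfect_matching H M && [disjoint M & S].
Proof. by rewrite /perfect_matching /del_edges /= subsetD -!andbA [_ && [disjoint _ & _]]andbC. Qed.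

Lemma anti_forcingP H M S : perfect_matching H M ->
  reflect [/\ S \subset eset H, [disjoint M & S]
     & forall N, perfect_matching H N -> [disjoint N & S] -> N = M]
   (anti_forcing H M S).
Proof.
move=> pM; apply: (iffP andP); rewrite subsetD [[disjoint S & M]]disjoint_sym.
  case=> /andP[sS dS] /forallP u; split=> // N pN dN.
  by apply/eqP; rewrite -(eqP (u N)) del_edges_pm pN.
case=> sS dS u; split; first by rewrite sS.
apply/forallP => N; rewrite del_edges_pm; apply/eqP; apply/andP/eqP => [[]|->] //.
exact: u.
Qed.

Lemma ledges_nonempty c d L : set0 \notin ledges c d L.
Proof.
have pE a A : set0 \notin path_edges a A.
  elim: A a => [|b A IH] a /=; rewrite ?inE // negb_or IH andbT.
  by apply/eqP => /setP/(_ a); rewrite !inE eqxx.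
have rE a b : set0 != [set a; b] by apply/eqP => /setP/(_ a); rewrite !inE eqxx.
by elim: L c d => [|F L IH] c d /=; rewrite !inE ?negb_or ?pE ?IH ?rE.
Qed.

(** A matching that avoids this set lies inside [M], and since no edge is empty it cannot be smaller
    while covering the same vertices. This makes the minimum in [af] a genuine one. *)
Lemma anti_forcing_default c d L M : lmatch c d L true M ->
  anti_forcing (lgraph c d L) M (eset (lgraph c d L) :\: M).
Proof.
rewrite -lgraph_pm => pM; apply/anti_forcingP => //; split; first exact: subsetDl.
  by rewrite disjoint_sym; apply/setDidPl; rewrite setDDl setUid.
move=> N pN dN; rewrite !lgraph_pm in pM pN; apply: (matches_eq _ pM pN).
  by apply: contra (ledges_nonempty c d L); apply: subsetP (matches_sub pM) _.
apply/subsetP => x xN; apply: contraT => xM.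
by have := disjointFr dN xN; rewrite inE xM (subsetP (matches_sub pN) _ xN).
Qed.

Theorem Af_ladder c d L : wf_ladder c d L -> last_kinky L -> Af (lgraph c d L) = gnum L.
Proof.
move=> wf lK; apply/eqP; rewrite eqn_leq; apply/andP; split.
  apply/bigmax_leqP => M pM; have pM' := pM; rewrite lgraph_pm in pM'.
  have [/(_ pM')[S [sS dS lS fS]] _ _] := upper_bounds M wf lK.
  rewrite /af; case: arg_minnP => [|S' _ minS']; first exact: anti_forcing_default.
  apply: leq_trans lS; apply: minS'; apply/anti_forcingP => //; split=> // N.
  by rewrite lgraph_pm; apply: fS; rewrite /= eqxx.
have [_ [M [pM nM]] _] := lower_bounds wf.
have pM' := pM; rewrite -lgraph_pm in pM'.
apply: (leq_trans _ (leq_bigmax_cond _ pM')).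
rewrite /af; case: arg_minnP => [|S' aS' _]; first exact: anti_forcing_default.
have [_ dS uS] := anti_forcingP _ pM' aS'; apply: nM => // N pN.
by apply: uS; rewrite lgraph_pm.
Qed.

End LadderGraph.

(** * The all-kink decomposition *)

Section Stripping.
Variable T : finType.
Implicit Types (x y e : {set T}) (E M N S : {set {set T}}) (X Y : {set T}).
Implicit Types (a b c d v : T) (A B : seq T).
Implicit Types (F : seq T * seq T) (L : ladder T) (H K : graph T).

Lemma del_verticesU H X Y : del_vertices (del_vertices H X) Y = del_vertices H (X :|: Y).
Proof.
congr pair; first by rewrite /= setDDl.
apply/setP => x; rewrite !inE -andbA.
by rewrite -!setI_eq0 setIUr setU_eq0.
Qed.

Definition closed_graph H := {in eset H, forall x, x \subset vset H}.

Lemma closed_del H X : closed_graph H -> closed_graph (del_vertices H X).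
Proof.
move=> cH x; rewrite inE => /andP[xH dx]; apply/subsetP => v vx.
by rewrite inE (disjointFr dx vx) (subsetP (cH _ xH)).
Qed.

Definition matchable H := exists M, perfect_matching H M.

Lemma pendantP H x : reflect
  (x \in eset H /\ exists2 v, v \in x & [set y in eset H | v \in y] = [set x]) (pendant H x).
Proof.
apply: (iffP andP) => -[xH h]; split=> //; move: h.
  case/exists_inP => v vx /cards1P[y ey]; exists v => //.
  have : x \in [set y in eset H | v \in y] by rewrite inE xH.
  by rewrite ey => /set1P->.
case=> v vx ev; apply/exists_inP; exists v => //.
by rewrite /degree ev cards1.
Qed.

Lemma pendant_match H M x : closed_graph H -> perfect_matching H M -> pendant H x -> x \in M.
Proof.
move=> cH; rewrite (perfect_matchingE _ cH) => pM /pendantP[xH [v vx ev]].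
have [y yM vy] := matches_ex pM (subsetP (cH _ xH) _ vx).
have : y \in [set y in eset H | v \in y] by rewrite inE (subsetP (matches_sub pM)).
by rewrite ev => /set1P <-.
Qed.

Lemma pendant_matchable H x : closed_graph H -> matchable H -> pendant H x ->
  matchable (del_vertices H x).
Proof.
move=> cH [M pM] px; have xM := pendant_match cH pM px.
move: pM; rewrite (perfect_matchingE _ cH) => pM.
exists (M :\ x); rewrite (perfect_matchingE _ (closed_del cH)).
apply: (matches_weak _ (matches_rem xM pM)).
apply/subsetP => y /setD1P[yx yM]; rewrite inE (subsetP (matches_sub pM)) //=.
apply/pred0P => v; apply/negP => /andP[/= vy vx].
by move: yx; rewrite (matches_inj pM yM xM vy vx) eqxx.
Qed.

Lemma pendant_disjoint H x y : closed_graph H -> matchable H -> pendant H x -> pendant H y ->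
  x != y -> [disjoint x & y].
Proof.
move=> cH [M pM] px py xy.
have xM := pendant_match cH pM px; have yM := pendant_match cH pM py.
move: pM; rewrite (perfect_matchingE _ cH) => pM.
apply/pred0P => v; apply/negP => /andP[/= vx vy].
by move: xy; rewrite (matches_inj pM xM yM vx vy) eqxx.
Qed.

Lemma pendant_del H x y : pendant H y -> [disjoint y & x] -> pendant (del_vertices H x) y.
Proof.
move=> /pendantP[yH [v vy ev]] d; apply/pendantP; split; first by rewrite inE yH.
exists v => //; apply/setP => z; rewrite !inE.
have : (z \in [set y0 in eset H | v \in y0]) = (z \in [set y]) by rewrite ev.
rewrite !inE; case: eqVneq => [-> /andP[-> ->]|_]; first by rewrite d.
by case: (_ \in _); case: (_ \in _) => //=; rewrite andbF.
Qed.

(** Distinct pendant edges belong to a common perfect matching, so they are disjoint and either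
    remains pendant once the other is removed. Hence any stripping sequence can be rearranged to
    start with [x]. *)
Lemma strips_pendant H K x : closed_graph H -> matchable H -> pendant H x ->
  strips_to H K -> strips_to (del_vertices H x) K.
Proof.
move=> + + + sK; elim: sK x => {H K} [H nH|H K y py sK IH] x cH mH px.
  by move: (nH x); rewrite px.
case: (eqVneq x y) => [->//|xy].
have dxy := pendant_disjoint cH mH px py xy.
have := IH x (closed_del cH) (pendant_matchable cH mH py) (pendant_del px dxy).
rewrite del_verticesU setUC -del_verticesU; apply: strips_step.
by apply: pendant_del py _; rewrite disjoint_sym.
Qed.

Lemma strips_unique H K K' : closed_graph H -> matchable H ->
  strips_to H K -> strips_to H K' -> K = K'.
Proof.
move=> + + sK; elim: sK K' => {H K} [H nH|H K x px sK IH] K' cH mH sK'.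
  by case: sK' nH => // H' K'' x px _ /(_ x); rewrite px.
exact: IH (closed_del cH) (pendant_matchable cH mH px) (strips_pendant cH mH px sK').
Qed.

Definition chain_edges p : {set {set T}} := if p is u :: s then path_edges u s else set0.
Definition inits p : seq T := if p is u :: s then belast u s else [::].

(** Only the last vertex of the path may have edges leaving it, so its first edge is pendant. Each
    removal takes two vertices, whence the parity condition. *)
Lemma strips_path p H K : ~~ odd (size p) -> uniq p -> chain_edges p \subset eset H ->
  (forall x w, x \in eset H -> w \in inits p -> w \in x -> x \in chain_edges p) ->
  strips_to (del_vertices H [set v in p]) K -> strips_to H K.
Proof.
have [n] := ubnP (size p); elim: n p H => // n IH [|u [|v p]] H //= sp ep Up sE nE sK.
  have -> // : H = del_vertices H [set v in [::]].
  case: H {sE nE sK} => V E; congr pair; first by rewrite /= set_nil setD0.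
  apply/setP => x; rewrite inE set_nil /= -setI_eq0 setI0 eqxx andbT //.
have uvE : [set u; v] \in eset H by apply: (subsetP sE); rewrite !inE eqxx.
case/and3P: Up; rewrite inE negb_or => /andP[uv up] vp Up.
have puv : pendant H [set u; v].
  apply/pendantP; split=> //; exists u; first by rewrite set21.
  apply/setP => x; rewrite !inE; apply/andP/eqP => [[xH ux]|->]; last by rewrite set21.
  have := nE x u xH (mem_head _ _) ux; case/setU1P => // /path_edges_memP/(_ ux).
  by rewrite inE (negPf uv) (negPf up).
apply: (strips_step puv); apply: (IH p) => //; first exact: ltnW sp.
- by rewrite negbK in ep.
- apply/subsetP => x xp; rewrite inE; apply/andP; split.
    apply: (subsetP sE); move: xp; case: (p) => [|w s] /= xp; first by rewrite inE in xp.
    by rewrite !inE xp !orbT.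
  apply/pred0P => w; apply/negP => /andP[/= wx].
  have wp : w \in p by case: (p) xp => [|z s] /=; [rewrite inE | move/path_edges_memP; apply].
  by rewrite !inE => /orP[]/eqP e; move: up vp; rewrite -e wp // => _; rewrite e.
- move=> x w; rewrite inE => /andP[xH dx] wp wx.
  have wup : w \in u :: belast v p by case: (p) wp => //= z s wp; rewrite !inE wp !orbT.
  have := nE x w xH wup wx; case/setU1P => [ex|].
    by have := disjointFr dx (_ : u \in x); rewrite ex !inE eqxx => /(_ isT).
  case: (p) => //= z s; case/setU1P => // ex.
  by have := disjointFr dx (_ : v \in x); rewrite ex !inE eqxx orbT => /(_ isT).
rewrite del_verticesU; have -> // : [set u; v] :|: [set v0 in p] = [set v0 in [:: u, v & p]].
by apply/setP => w; rewrite !inE orbA.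
Qed.

End Stripping.

(** * Degrees, cyclomatic number and stripping of ladders *)

Section Counting.
Variable T : finType.
Implicit Types (x y e : {set T}) (E M N S : {set {set T}}) (X Y : {set T}).
Implicit Types (a b c d v : T) (A B : seq T).
Implicit Types (F : seq T * seq T) (L : ladder T) (H K : graph T).

Lemma cover_numU E E' v : [disjoint E & E'] ->
  cover_num (E :|: E') v = cover_num E v + cover_num E' v.
Proof.
move=> dE; have e : [set x in E :|: E' | v \in x] = [set x in E | v \in x] :|: [set x in E' | v \in x].
  by apply/setP => x; rewrite !inE andb_orl.
rewrite /cover_num e cardsU -[X in _ - X]/(#|_ :&: _|).
suff -> : [set x in E | v \in x] :&: [set x in E' | v \in x] = set0 by rewrite cards0 subn0.
apply/setP => x; rewrite !inE; apply/negP => /andP[/andP[xE _] /andP[xE' _]].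
by rewrite (disjointFr dE xE) in xE'.
Qed.

Lemma cards_disjU E E' : [disjoint E & E'] -> #|E :|: E'| = #|E| + #|E'|.
Proof. by rewrite -setI_eq0 => /eqP e; rewrite cardsU e cards0 subn0. Qed.

Lemma path_edge_fresh a b A : uniq [:: a, b & A] -> [set a; b] \notin path_edges b A.
Proof.
case/andP => h _; apply/negP => /path_edges_memP/(_ (set21 a b)); exact/negP.
Qed.

Lemma card_path_edges a A : uniq (a :: A) -> #|path_edges a A| = size A.
Proof.
elim: A a => [|b A IH] a U /=; first by rewrite cards0.
by rewrite cardsU1 path_edge_fresh //= IH //; case/andP: U.
Qed.

Lemma cover_path a A v : uniq (a :: A) ->
  cover_num (path_edges a A) v = (v \in belast a A) + (v \in A).
Proof.
elim: A a => [|b A IH] a U /=; first by apply: eq_card0 => x; rewrite !inE.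
rewrite cover_numU1 ?path_edge_fresh // IH; last by case/andP: U.
have aN : a \notin b :: A by case/andP: U.
have nb : (a \in belast b A) = false by apply: contraNF aN => /mem_belast.
have nA : (a \in A) = false by apply: contraNF aN => h; rewrite inE h orbT.
have bA : (b \in A) = false by case/and3P: U => _ /negPf.
rewrite /= !inE; have [->|va] := eqVneq v a.
  have /negPf-> : a != b by apply: contraNneq aN => ->; rewrite mem_head.
  by rewrite nb nA.
have [->|//] := eqVneq v b; rewrite bA /=; lia.
Qed.

Lemma wf_disjoint_edges c d A B L : wf_ladder c d ((A, B) :: L) ->
  [/\ [disjoint path_edges c A & path_edges d B :|: ledges (last c A) (last d B) L],
      [disjoint path_edges d B & ledges (last c A) (last d B) L]
    & [set c; d] \notin path_edges c A :|: (path_edges d B :|: ledges (last c A) (last d B) L)].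
Proof.
move=> wf; split.
- exact: path_edges_fresh (wf_fresh1 wf).
- exact: path_edges_fresh (wf_fresh2 wf).
exact: wf_rung wf.
Qed.

Lemma cover_ladder c d A B L v : wf_ladder c d ((A, B) :: L) ->
  cover_num (ledges c d ((A, B) :: L)) v =
    (v \in [set c; d]) + ((v \in belast c A) + (v \in A) + ((v \in belast d B) + (v \in B) +
     cover_num (ledges (last c A) (last d B) L) v)).
Proof.
move=> wf; have [h1 h2 h3] := wf_disjoint_edges wf.
case: (wf_consP wf) => -[UA UB _] _ _ _ _.
by rewrite /= cover_numU1 // !cover_numU // !cover_path.
Qed.

Lemma card_ledges c d L : wf_ladder c d L -> #|ledges c d L| = size (lverts L) + (size L).+1.
Proof.
elim: L c d => [|[A B] L IH] c d wf; first by rewrite /= cards1.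
have [h1 h2 h3] := wf_disjoint_edges wf.
case: (wf_consP wf) => -[UA UB _] _ _ wfL _.
rewrite /= cardsU1 h3 !cards_disjU // !card_path_edges // IH // !size_cat; lia.
Qed.

Lemma cyclomatic_ladder c d L : wf_ladder c d L -> cyclomatic (lgraph c d L) = size L.
Proof.
move=> wf; rewrite /cyclomatic card_ledges //.
have -> : #|vset (lgraph c d L)| = (size (lverts L)).+2.
  by rewrite /= cardsE; case/andP: wf => /card_uniqP -> _.
lia.
Qed.

(** A vertex on a side of a face meets an edge before it, the left rung for the first vertex, and an
    edge after it, the next rung for the last vertex. The fact [key] adds up these two
    contributions. *)
Lemma ladder_degree c d L v : L != [::] -> wf_ladder c d L -> v \in vset (lgraph c d L) ->
  1 < degree (lgraph c d L) v.
Proof.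
rewrite -[degree _ _]/(cover_num (ledges c d L) v) inE.
elim: L c d => [|[A B] L IH] c d // _ wf; rewrite (cover_ladder v wf).
case: (wf_consP wf) => -[UA UB dAB] dA dB wfL [oddB pos].
have rc w : w \in [set last c A; last d B] -> 0 < cover_num (ledges (last c A) (last d B) L) w.
  by move=> wr; apply/card_gt0P; exists [set last c A; last d B]; rewrite inE rung_ledges.
have inA a s : v \in a :: s -> v != last a s -> v \in belast a s.
  by rewrite lastI mem_rcons inE => /orP[->|].
have key n0 n1 n2 n3 n4 n5 :
    (0 < n0 + n2) && (0 < n1 + n5) || (0 < n0 + n4) && (0 < n3 + n5) ->
    1 < n0 + (n1 + n2 + (n3 + n4 + n5)) by lia.
have pos1 (b1 b2 : bool) : b1 || b2 -> 0 < b1 + b2 by case: b1; case: b2.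
have [vA|vA] := boolP (v \in c :: A).
  move=> _; apply: key; apply/orP; left; rewrite pos1 /=; last first.
    by move: vA; rewrite !inE => /orP[]->; rewrite ?orbT.
  rewrite addn_gt0; have [e|/(inA _ _ vA) -> //] := eqVneq v (last c A).
  by rewrite rc ?orbT // e set21.
have [vB|vB] := boolP (v \in d :: B).
  move=> _; apply: key; apply/orP; right; rewrite pos1 /=; last first.
    by move: vB; rewrite !inE => /orP[]->; rewrite ?orbT.
  rewrite addn_gt0; have [e|/(inA _ _ vB) -> //] := eqVneq v (last d B).
  by rewrite rc ?orbT // e set22.
move=> vV; have vL : v \in lverts L.
  move: vV vA vB; rewrite /= !inE !mem_cat.
  by case: (v == c); case: (v == d); case: (v \in A); case: (v \in B).
have L0 : L != [::] by case: (L) vL.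
have := IH _ _ L0 wfL; rewrite in_cons in_cons vL !orbT => /(_ isT) h.
by apply: leq_trans h _; rewrite !addnA leq_addl.
Qed.

Lemma ladder_no_pendant c d L x : L != [::] -> wf_ladder c d L -> ~~ pendant (lgraph c d L) x.
Proof.
move=> L0 wf; apply/negP => /andP[xL /exists_inP[v vx /eqP dv]].
have := ladder_degree L0 wf (subsetP (eset_lgraph xL) _ vx).
by rewrite dv.
Qed.

Definition rest c d L : graph T := del_vertices (lgraph c d L) [set c; d].

Lemma inits_cat A A' v : uniq (A ++ A') -> v \in inits A -> v \in inits (A ++ A').
Proof. by case: A => //= a A _; rewrite belast_cat mem_cat => ->. Qed.

Lemma chain_edges_cat A A' x w : uniq (A ++ A') -> x \in chain_edges (A ++ A') ->
  w \in inits A -> w \in x -> x \in chain_edges A.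
Proof.
case: A => //= a A; elim: A a => [|b A IH] a //= U; rewrite in_setU1 => /orP[xe|xA].
  by rewrite (eqP xe) !inE eqxx.
rewrite in_cons => /orP[/eqP->|wb] wx; last by rewrite inE (IH b _ xA wb wx) ?orbT //; case/andP: U.
by have := path_edges_memP xA wx; case/andP: U => /negPf->.
Qed.

Lemma path_edges_chain c A x : x \in path_edges c A -> c \notin x -> x \in chain_edges A.
Proof. by case: A => //= a A; rewrite in_setU1 => /orP[/eqP->|//]; rewrite set21. Qed.

Lemma chain_edges_path c A : chain_edges A \subset path_edges c A.
Proof. by case: A => [|a A] /=; rewrite ?sub0set // subsetUr. Qed.

Lemma chain_edges_mono A A' : chain_edges A \subset chain_edges (A ++ A').
Proof.
case: A => [|a A] /=; first exact: sub0set.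
by elim: A a => [|b A IH] a /=; [exact: sub0set | exact: setUS].
Qed.

Lemma chain_edges_mem A x v : x \in chain_edges A -> v \in x -> v \in A.
Proof. by case: A => [|a A] /=; [rewrite inE | apply: path_edges_memP]. Qed.

Lemma inits_belast c A v : v \in inits A -> v \in belast c A.
Proof. by case: A => //= a A; rewrite inE => ->; rewrite orbT. Qed.

Lemma inits_mem A v : v \in inits A -> v \in A.
Proof. by case: A => //= a A; apply: mem_belast. Qed.

(* Deleting the rung leaves both sides of the first face as pendant paths. *)
Lemma strips_sides c d A1 A2 B1 B2 L K (H := lgraph c d ((A1 ++ A2, B1 ++ B2) :: L)) :
  wf_ladder c d ((A1 ++ A2, B1 ++ B2) :: L) -> ~~ odd (size A1) -> ~~ odd (size B1) ->
  strips_to (del_vertices H ([set c; d] :|: [set v in A1] :|: [set v in B1])) K ->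
  strips_to (rest c d ((A1 ++ A2, B1 ++ B2) :: L)) K.
Proof.
move=> wf eA eB sK; case: (wf_consP wf) => -[UA UB dAB] dA dB wfL _.
have f1 := wf_fresh1 wf; have f2 := wf_fresh2 wf.
have cA : {in A1, forall v, v != c /\ v != d}.
  move=> v vA; split; first by case/andP: UA => h _; apply: contraNneq h => <-; rewrite mem_cat vA.
  by have := dAB v; rewrite !inE mem_cat vA orbT => /(_ isT); rewrite negb_or => /andP[].
have cB : {in B1, forall v, v != c /\ v != d}.
  move=> v vB; split; last by case/andP: UB => h _; apply: contraNneq h => <-; rewrite mem_cat vB.
  have := dAB c (mem_head _ _); rewrite inE negb_or mem_cat => /andP[_]; apply: contraNneq => <-.
  by rewrite vB.
have AB : {in A1, forall v, v \notin B1}.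
  move=> v vA; have := dAB v; rewrite !inE mem_cat vA orbT => /(_ isT); rewrite negb_or mem_cat.
  by case/andP => _; rewrite negb_or => /andP[].
have U1 : uniq A1 by move: UA; rewrite /= cat_uniq => /and4P[].
have U2 : uniq B1 by move: UB; rewrite /= cat_uniq => /and4P[].
have UAA : uniq (A1 ++ A2) by case/andP: UA.
have UBB : uniq (B1 ++ B2) by case/andP: UB.
apply: (strips_path (p := A1)) => //.
- apply/subsetP => x xA; rewrite inE /=; apply/andP; split.
    have := subsetP (subset_trans (chain_edges_mono _ A2) (chain_edges_path c _)) _ xA.
    by rewrite !inE => ->; rewrite !orbT.
  apply/pred0P => v; apply/negP => /andP[/= vx].
  by have [/negPf vc /negPf vd] := cA _ (chain_edges_mem xA vx); rewrite !inE vc vd.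
- move=> x w; rewrite inE /= => /andP[xL dx] wA wx.
  have wA' := inits_belast c (inits_cat UAA wA).
  apply: (chain_edges_cat UAA _ wA wx); apply: (@path_edges_chain c).
    case/setU1P: xL => [ex|/setUP[//|/(f1 _ _ wA')]]; last by rewrite wx.
    by have [/negPf h1 /negPf h2] := cA _ (inits_mem wA); move: wx; rewrite ex !inE h1 h2.
  by apply/negP => /(disjointFr dx); rewrite set21.
rewrite /rest del_verticesU; apply: (strips_path (p := B1)) => //.
- apply/subsetP => x xB; rewrite inE /=; apply/andP; split.
    have := subsetP (subset_trans (chain_edges_mono _ B2) (chain_edges_path d _)) _ xB.
    by rewrite !inE => ->; rewrite !orbT.
  apply/pred0P => v; apply/negP => /andP[/= vx]; have vB := chain_edges_mem xB vx.
  have [/negPf vc /negPf vd] := cB _ vB; rewrite !inE vc vd /= => vA.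
  by have := AB _ vA; rewrite vB.
- move=> x w; rewrite inE /= => /andP[xL dx] wB wx.
  have wB' := inits_belast d (inits_cat UBB wB).
  apply: (chain_edges_cat UBB _ wB wx); apply: (@path_edges_chain d).
    case/setU1P: xL => [ex|/setUP[xA|/setUP[//|/(f2 _ _ wB')]]]; last by rewrite wx.
      by have [/negPf h1 /negPf h2] := cB _ (inits_mem wB); move: wx; rewrite ex !inE h1 h2.
    have wA := path_edges_memP xA wx.
    by have := dAB _ wA; rewrite (mem_belast wB').
  by apply/negP => /(disjointFr dx); rewrite !inE eqxx orbT.
by rewrite del_verticesU.
Qed.

Lemma del_sides_edges c d A B L X x : wf_ladder c d ((A, B) :: L) ->
  c \in X -> {subset belast c A <= X} -> {subset belast d B <= X} -> [disjoint x & X] ->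
  (x \in ledges c d ((A, B) :: L)) = (x \in ledges (last c A) (last d B) L).
Proof.
move=> wf cX sA sB dx; have nx v : v \in X -> v \notin x.
  by move=> vX; apply/negP => /(disjointFr dx); rewrite vX.
rewrite !inE -[ledges (last c (A, B).1) _ _]/(ledges (last c A) (last d B) L).
case: eqVneq => [ex|_] /=; first by have := nx c cX; rewrite ex set21.
have -> : (x \in path_edges c A) = false.
  by apply/negP => /path_edges_belast[v /sA/nx /negP].
have -> // : (x \in path_edges d B) = false.
by apply/negP => /path_edges_belast[v /sB/nx /negP].
Qed.

Lemma wf_belast c d A B L v : wf_ladder c d ((A, B) :: L) ->
  (v \in belast c A) || (v \in belast d B) -> v \notin last c A :: last d B :: lverts L.
Proof.
move=> wf; case: (wf_consP wf) => -[UA UB dAB] dA dB wfL _.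
case/orP=> h; have h' := mem_belast h; rewrite !inE !negb_or (belast_last_notin _ h) //=.
  rewrite (dA _ h') andbT; apply: contraNneq (dAB _ h') => ->; exact: mem_last.
rewrite (dB _ h') andbT; apply: contraTneq h' => ->; apply: dAB; exact: mem_last.
Qed.

Lemma del_sides c d A B L X : wf_ladder c d ((A, B) :: L) ->
  c \in X -> {subset belast c A <= X} -> {subset belast d B <= X} ->
  del_vertices (lgraph c d ((A, B) :: L)) X = del_vertices (lgraph (last c A) (last d B) L) X.
Proof.
move=> wf cX sA sB; congr pair; apply/setP => v; last first.
  rewrite inE [RHS]inE; case: (boolP [disjoint v & X]) => dx; last by rewrite !andbF.
  by rewrite !andbT; have := del_sides_edges wf cX sA sB dx.
rewrite in_setD [RHS]in_setD; case: (boolP (v \in X)) => //= vX.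
have nA : v \in c :: A -> v = last c A.
  by rewrite lastI mem_rcons inE => /orP[/eqP//|/sA]; rewrite (negPf vX).
have nB : v \in d :: B -> v = last d B.
  by rewrite lastI mem_rcons inE => /orP[/eqP//|/sB]; rewrite (negPf vX).
have la := mem_last c A; have lb := mem_last d B.
apply/idP/idP; rewrite !inE !mem_cat.
  case/or4P=> [/eqP e|/eqP e|h|/orP[h|->]]; last by rewrite !orbT.
  - by rewrite nA ?eqxx // e mem_head.
  - by rewrite [v == last d B](introT eqP (nB _)) ?orbT // e mem_head.
  - by rewrite nA ?eqxx // inE h orbT.
  - by rewrite [v == last d B](introT eqP (nB _)) ?orbT // inE h orbT.
case/or3P=> [/eqP e|/eqP e|->]; last by rewrite !orbT.
  by move: la; rewrite -e inE => /orP[]->; rewrite ?orbT.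
by move: lb; rewrite -e inE => /orP[]->; rewrite ?orbT.
Qed.

Lemma del_vertices_eq H X Y : closed_graph H -> {in vset H, X =i Y} ->
  del_vertices H X = del_vertices H Y.
Proof.
move=> cH eXY; congr pair; apply/setP => v; rewrite !inE.
  by case: (boolP (v \in vset H)) => vH; rewrite ?andbF // eXY.
case: (boolP (v \in eset H)) => //= vH.
have e w : w \in v -> (w \in X) = (w \in Y).
  by move=> wv; apply: eXY; apply: (subsetP (cH _ vH)).
by congr (_ == _); apply: eq_card => w; rewrite !inE; case: (boolP (w \in v)) => [/e|]; rewrite ?andbF //= .
Qed.

Lemma del_vertices0 H : del_vertices H set0 = H.
Proof.
case: H => V E; congr pair; rewrite /= ?setD0 //.
by apply/setP => x; rewrite inE -setI_eq0 setI0 eqxx andbT.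
Qed.

(** Odd sides: an even number of vertices is stripped from each, all but the last, so the next rung
    survives and stripping goes on with the whole remaining ladder. *)
Lemma strips_kinky c d F L K : wf_ladder c d (F :: L) -> kinky F ->
  strips_to (lgraph (last c F.1) (last d F.2) L) K -> strips_to (rest c d (F :: L)) K.
Proof.
case: F => A B wf; rewrite /kinky /= => kA; case: (wf_consP wf) => _ _ _ _ [oddB _].
case/lastP: A kA wf oddB => // A a kA wf.
case/lastP: B wf => [|B b] wf oddB; first by rewrite kA in oddB.
have := wf_belast wf; rewrite !last_rcons !belast_rcons => nb.
move: wf oddB kA; rewrite -!cats1 => wf oddB kA sK.
apply: strips_sides => //; first by move: kA; rewrite size_cat addn1.
  by move: oddB; rewrite kA size_cat addn1 /= => ->.
rewrite del_sides //; first last.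
- by move=> v; rewrite cats1 belast_rcons !inE => /orP[->|->]; rewrite ?orbT.
- by move=> v; rewrite cats1 belast_rcons !inE => /orP[->|->]; rewrite ?orbT.
- by rewrite !inE eqxx.
rewrite !last_cat /= (del_vertices_eq (Y := set0)) ?del_vertices0 //.
  exact: eset_lgraph.
move=> v; rewrite inE => vL; rewrite !inE; apply/negP => h.
have hv : (v \in c :: A) || (v \in d :: B).
  by move: h; rewrite !inE; case: (v == c); case: (v == d); case: (v \in A).
by move: (nb v hv); rewrite vL.
Qed.

(** Even sides are consumed entirely, up to and including the ends of the next rung, which
    reproduces the initial situation one face further. *)
Lemma strips_nonkinky c d F L K : wf_ladder c d (F :: L) -> ~~ kinky F ->
  strips_to (rest (last c F.1) (last d F.2) L) K -> strips_to (rest c d (F :: L)) K.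
Proof.
case: F => A B wf; rewrite /kinky /= => kA; case: (wf_consP wf) => _ _ _ _ [oddB _].
have nb := fun v => @wf_belast c d A B L v wf; move=> sK.
rewrite -(cats0 A) -(cats0 B); rewrite -(cats0 A) -(cats0 B) in wf.
apply: strips_sides => //; first by rewrite oddB.
rewrite del_sides //; first last.
- by move=> v; rewrite cats0 => /mem_belast; rewrite !inE => /orP[->|->]; rewrite ?orbT.
- by move=> v; rewrite cats0 => /mem_belast; rewrite !inE => /orP[->|->]; rewrite ?orbT.
- by rewrite !inE eqxx.
rewrite !cats0 (del_vertices_eq (Y := [set last c A; last d B])) //.
  exact: eset_lgraph.
move=> v; rewrite inE => vL; rewrite !inE.
have := nb v; rewrite vL => nb'.
have mA : (v == c) || (v \in A) = (v == last c A) || (v \in belast c A).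
  by rewrite -in_cons lastI mem_rcons inE.
have mB : (v == d) || (v \in B) = (v == last d B) || (v \in belast d B).
  by rewrite -in_cons lastI mem_rcons inE.
transitivity (((v == c) || (v \in A)) || ((v == d) || (v \in B))).
  by case: (v == c); case: (v == d); case: (v \in A); case: (v \in B).
rewrite mA mB; move: nb'; case: (v \in belast c A); first by move=> /(_ isT).
case: (v \in belast d B); first by move=> /(_ isT).
by rewrite !orbF.
Qed.

Lemma rest_nil c d : rest c d [::] = @empty_graph T.
Proof.
congr pair; apply/setP => x; rewrite !inE; first by rewrite andNb.
case: eqVneq => //= ->; rewrite -setI_eq0 setIid; apply/negP => /eqP/setP/(_ c).
by rewrite !inE eqxx.
Qed.

Lemma strips_empty : strips_to (@empty_graph T) (@empty_graph T).
Proof. by apply: strips_done => x; rewrite /pendant inE. Qed.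

Lemma strips_rung c d : c != d -> strips_to (lgraph c d [::]) (@empty_graph T).
Proof.
move=> cd; apply: (strips_step (x := [set c; d])); last by rewrite -/(rest c d [::]) rest_nil; apply: strips_empty.
apply/pendantP; split; first by rewrite /= set11.
exists c; first by rewrite set21.
by apply/setP => x; rewrite !inE; case: eqVneq => //= ->; rewrite !inE eqxx.
Qed.

Lemma rest_matchable c d L : wf_ladder c d L -> matchable (rest c d L).
Proof.
(* The existence of a matching that leaves the first rung uncovered is borrowed from the lower
   bound. *)
move=> wf; have [_ _ [M [pM _]]] := lower_bounds wf; exists M.
rewrite (perfect_matchingE _ (closed_del (@eset_lgraph _ c d L))).
have [sM cM] := matchesP _ _ _ pM; apply/matchesP; split; last first.
  move=> v; rewrite cM !inE /=; case/andP: wf => /= /and3P[]; rewrite inE negb_or => /andP[_ cL] dL _ _.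
  have [->|_] := eqVneq v c; first by rewrite (negPf cL).
  by have [->|_] := eqVneq v d; rewrite ?(negPf dL).
apply/subsetP => x xM; rewrite inE (subsetP sM _ xM) /=.
apply/pred0P => v; apply/negP => /andP[/= vx].
have := matches_mem pM xM vx; rewrite inE /= => vL.
case/andP: wf => /= /and3P[]; rewrite inE negb_or => /andP[_ cL] dL _ _.
by rewrite !inE => /orP[]/eqP e; move: vL; rewrite e ?(negPf cL) ?(negPf dL).
Qed.

Definition end1 c L := foldl (fun c F => last c F.1) c L.
Definition end2 d L := foldl (fun d F => last d F.2) d L.

(** The recursion of [hnum] imitates stripping: it passes over non-kinks and restarts as [gnum]
    behind the first kink. Nothing survives if there is no kink or if the first one is the last
    face, since a single rung is itself stripped. *)
Lemma strips_rest c d L : wf_ladder c d L -> exists2 K, strips_to (rest c d L) K &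
  K = empty_graph T /\ hnum L = 0 \/
  exists2 k, k < size L & K = lgraph (end1 c (take k L)) (end2 d (take k L)) (drop k L) /\
     hnum L = gnum (drop k L).
Proof.
elim: L c d => [|F L IH] c d wf.
  by exists (empty_graph T); [rewrite rest_nil; apply: strips_empty | left].
have wfL := wf_tail wf; rewrite hnum_cons.
case: (boolP (kinky F)) => kF.
  case: (eqVneq L [::]) => [eL|L0].
    exists (empty_graph T); last by left; rewrite eL.
    apply: strips_kinky => //; rewrite eL; apply: strips_rung; exact: wf_neq wfL.
  exists (lgraph (last c F.1) (last d F.2) L).
    apply: strips_kinky => //; apply: strips_done => x; exact: ladder_no_pendant.
  right; exists 1; first by rewrite /= ltnS lt0n size_eq0.
  by rewrite /= take0 drop0.
have [K sK hK] := IH _ _ wfL; exists K; first exact: strips_nonkinky.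
by case: hK => [|[k lk hk]]; [left | right; exists k.+1].
Qed.

End Counting.

(** * Faces and kinks of a ladder, and the sum over its all-kink decomposition *)

Section Decomposition.
Variable T : finType.
Implicit Types (x y e : {set T}) (E M N S : {set {set T}}) (X Y : {set T}).
Implicit Types (a b c d v : T) (A B : seq T).
Implicit Types (F : seq T * seq T) (L : ladder T) (H K : graph T).

Fixpoint face_graphs c d L : seq (graph T) :=
  if L is F :: L' then lgraph c d [:: F] :: face_graphs (last c F.1) (last d F.2) L'
  else [::].

Lemma size_face_graphs c d L : size (face_graphs c d L) = size L.
Proof. by elim: L c d => //= F L IH c d; rewrite IH. Qed.

Lemma take_face_graphs c d L i : take i (face_graphs c d L) = face_graphs c d (take i L).
Proof. by elim: L c d i => [|F L IH] c d [|i] //=; rewrite IH. Qed.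

Lemma drop_face_graphs c d L i : drop i (face_graphs c d L) =
  face_graphs (end1 c (take i L)) (end2 d (take i L)) (drop i L).
Proof. by elim: L c d i => [|F L IH] c d [|i] //=; rewrite IH. Qed.

Lemma face_graphs_cat c d L L' : face_graphs c d (L ++ L') =
  face_graphs c d L ++ face_graphs (end1 c L) (end2 d L) L'.
Proof. by elim: L c d => //= F L IH c d; rewrite IH. Qed.

Lemma lgraph_cons c d F L : lgraph c d (F :: L) =
  (vset (lgraph c d [:: F]) :|: vset (lgraph (last c F.1) (last d F.2) L),
   eset (lgraph c d [:: F]) :|: eset (lgraph (last c F.1) (last d F.2) L)).
Proof.
case: F => A B; congr pair; apply/setP => v; rewrite /= !inE; last first.
  have := rung_ledges (last c A) (last d B) L.
  have [->|_] := eqVneq v [set last c A; last d B]; first by move->; rewrite !orbT.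
  by case: (v == [set c; d]); case: (v \in path_edges c A); case: (v \in path_edges d B).
rewrite !mem_cat ?in_nil.
have h1 : (v == last c A) -> (v == c) || (v \in A).
  by move/eqP->; have := mem_last c A; rewrite inE.
have h2 : (v == last d B) -> (v == d) || (v \in B).
  by move/eqP->; have := mem_last d B; rewrite inE.
move: h1 h2; case: (v == c); case: (v == d); case: (v \in A); case: (v \in B) => //=;
  case: (v == last c A) => //= h; try (by have := h isT);
  case: (v == last d B) => //= h'; try (by have := h' isT).
Qed.

Lemma union_face_graphs c d L : L != [::] -> union_graph (face_graphs c d L) = lgraph c d L.
Proof.
elim: L c d => [|F L IH] c d // _; rewrite /union_graph /= !big_cons.
case: (eqVneq L [::]) => [->|L0]; first by rewrite !big_nil !setU0.
have := IH (last c F.1) (last d F.2) L0; rewrite /union_graph => -[-> ->].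
by rewrite -[RHS]/(lgraph c d (F :: L)) [RHS]lgraph_cons.
Qed.

Lemma lverts_cat L L' : lverts (L ++ L') = lverts L ++ lverts L'.
Proof. by elim: L => //= F L IH; rewrite IH !catA. Qed.

Lemma wf_cat c d L L' : wf_ladder c d (L ++ L') ->
  wf_ladder c d L /\ wf_ladder (end1 c L) (end2 d L) L'.
Proof.
move=> wf; split.
  case/andP: wf; rewrite lverts_cat all_cat => U /andP[eL _]; apply/andP; split=> //.
  by move: U; rewrite -!cat_cons cat_uniq => /and3P[].
by elim: L c d wf => //= F L IH c d /wf_tail/IH.
Qed.

Lemma wf_take c d L i : wf_ladder c d L -> wf_ladder c d (take i L).
Proof. by rewrite -{1}(cat_take_drop i L) => /wf_cat[]. Qed.

Lemma wf_drop c d L i : wf_ladder c d L ->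
  wf_ladder (end1 c (take i L)) (end2 d (take i L)) (drop i L).
Proof. by rewrite -{1}(cat_take_drop i L) => /wf_cat[]. Qed.

Lemma common_verts c d L L' v : wf_ladder c d (L ++ L') ->
  v \in vset (lgraph c d L) -> v \in vset (lgraph (end1 c L) (end2 d L) L') ->
  v \in [set end1 c L; end2 d L].
Proof.
case/andP=> + _; rewrite lverts_cat -!cat_cons cat_uniq => /and3P[_ /hasPn h _].
rewrite !inE => vL /or3P[->//|->|]; first by rewrite orbT.
by move/h; rewrite /= !inE vL.
Qed.

Lemma ledges_card2 c d L x : wf_ladder c d L -> x \in ledges c d L -> #|x| = 2.
Proof.
have pE a A y : uniq (a :: A) -> y \in path_edges a A -> #|y| = 2.
  elim: A a => [|b A IH] a; first by rewrite inE.
  rewrite /= inE negb_or => /and3P[/andP[ab _] bA U] /setU1P[->|/IH->//]; first by rewrite cards2 ab.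
  exact/andP.
elim: L c d => [|[A B] L IH] c d wf /=.
  by move/set1P->; rewrite cards2 (wf_neq wf).
case: (wf_consP wf) => -[UA UB _] _ _ wfL _.
case/setU1P=> [->|/setUP[/pE->//|/setUP[/pE->//|/IH->//]]].
by rewrite cards2 (wf_neq wf).
Qed.

Lemma face_graphs_sub c d L s : s \in face_graphs c d L ->
  vset s \subset vset (lgraph c d L) /\ eset s \subset eset (lgraph c d L).
Proof.
elim: L c d => // F L IH c d /predU1P[->|/IH[h1 h2]]; rewrite [lgraph c d (F :: L)]lgraph_cons.
  by split; apply: subsetUl.
by split; [apply: subset_trans h1 _ | apply: subset_trans h2 _]; apply: subsetUr.
Qed.

Lemma face_graphs_memP c d L s : s \in face_graphs c d L ->
  exists L1 F L2, L = L1 ++ F :: L2 /\ s = lgraph (end1 c L1) (end2 d L1) [:: F].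
Proof.
elim: L c d => //= F L IH c d; rewrite inE => /orP[/eqP->|/IH[L1 [F' [L2 [-> ->]]]]].
  by exists [::], F, L.
by exists (F :: L1), F', L2.
Qed.

Lemma face_last_rung c d A B : [set last c A; last d B] \in eset (lgraph c d [:: (A, B)]).
Proof. by rewrite /= !inE eqxx !orbT. Qed.

Lemma last_rung_in c d L : L != [::] ->
  exists2 s, s \in face_graphs c d L & [set end1 c L; end2 d L] \in eset s.
Proof.
case/lastP: L => // L [A B] _; rewrite -cats1 face_graphs_cat /end1 /end2 !foldl_cat /=.
exists (lgraph (end1 c L) (end2 d L) [:: (A, B)]); first by rewrite mem_cat mem_seq1 eqxx orbT.
exact: face_last_rung.
Qed.

(** Such a vertex is not on the left rung, so it distinguishes the face from those to its left. *)
Lemma face_private c d A B L : wf_ladder c d ((A, B) :: L) ->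
  exists2 v, v \in A ++ B & v \in vset (lgraph c d [:: (A, B)]).
Proof.
move=> wf; case: (wf_consP wf) => _ _ _ _ [_ pos].
case E : (A ++ B) => [|v s]; first by move: pos; rewrite -size_cat E.
exists v; first exact: mem_head.
by rewrite inE /= cats0 E !inE eqxx !orbT.
Qed.

(** Parts of the ladder on different sides of a rung have only its two ends in common, and a common
    edge needs two vertices, so it is the rung. *)
Lemma shared_face c d L1 F L2 (c1 := end1 c L1) (d1 := end2 d L1) :
  wf_ladder c d (L1 ++ F :: L2) ->
  shared_edges (face_graphs c d (L1 ++ F :: L2)) (lgraph c1 d1 [:: F]) =
    (if L1 == [::] then set0 else [set [set c1; d1]]) :|:
    (if L2 == [::] then set0 else [set [set last c1 F.1; last d1 F.2]]).
Proof.
case: F => A B wf; have [wf1 wf2] := wf_cat wf; rewrite -/c1 -/d1 in wf2.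
have [wfF wfL2] : wf_ladder c1 d1 [:: (A, B)] /\ wf_ladder (last c1 A) (last d1 B) L2.
  exact: (@wf_cat c1 d1 [:: (A, B)] L2 wf2).
set s := lgraph c1 d1 _.
have sV : vset s \subset vset (lgraph c1 d1 ((A, B) :: L2)).
  by rewrite [lgraph c1 d1 (_ :: L2)]lgraph_cons subsetUl.
have memS s' : s' \in face_graphs c d (L1 ++ (A, B) :: L2) ->
    [\/ s' \in face_graphs c d L1, s' = s | s' \in face_graphs (last c1 A) (last d1 B) L2].
  by rewrite face_graphs_cat mem_cat inE => /or3P[|/eqP|]; [constructor 1 | constructor 2 | constructor 3].
have bd x s' : x \in eset s -> s' \in face_graphs c d (L1 ++ (A, B) :: L2) -> s' != s -> x \in eset s' ->
    (L1 != [::]) && (x == [set c1; d1]) || (L2 != [::]) && (x == [set last c1 A; last d1 B]).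
  move=> xs /memS[sL1|->|sL2] ss xs'; last 2 first.
  - by rewrite eqxx in ss.
  - apply/orP; right; apply/andP; split; first by case: (L2) sL2.
    rewrite eqEcard cards2 (ledges_card2 wfF xs) (wf_neq wfL2) leqnn andbT.
    apply/subsetP => v vx; apply: (@common_verts c1 d1 [:: (A, B)] L2 v wf2).
      exact: subsetP (eset_lgraph xs) _ vx.
    have [_ sE] := face_graphs_sub sL2.
    exact: subsetP (eset_lgraph (subsetP sE _ xs')) _ vx.
  apply/orP; left; apply/andP; split; first by case: (L1) sL1.
  rewrite eqEcard cards2 (ledges_card2 wfF xs) (wf_neq wf2) leqnn andbT.
  apply/subsetP => v vx; apply: (common_verts wf).
    have [_ sE] := face_graphs_sub sL1.
    exact: subsetP (eset_lgraph (subsetP sE _ xs')) _ vx.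
  by apply: (subsetP sV); exact: subsetP (eset_lgraph xs) _ vx.
have sIn : s \in face_graphs c d (L1 ++ (A, B) :: L2).
  by rewrite face_graphs_cat mem_cat inE eqxx orbT.
have sh x s' : x \in eset s -> s' \in face_graphs c d (L1 ++ (A, B) :: L2) -> s' != s -> x \in eset s' ->
    x \in shared_edges (face_graphs c d (L1 ++ (A, B) :: L2)) s.
  move=> xs s'in ss xs'; rewrite inE xs; apply/hasP; exists s => //; apply/hasP; exists s' => //.
  by rewrite eq_sym ss inE xs.
have [v vAB vs] := face_private wfF.
case: (wf_consP wfF) => -[_ _ dAB] _ _ _ _.
apply/setP => x; apply/idP/idP.
  rewrite inE => /andP[xs /hasP[s1 s1in /hasP[s2 s2in /andP[s12]]]].
  rewrite inE => /andP[x1 x2].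
  have : (L1 != [::]) && (x == [set c1; d1]) || (L2 != [::]) && (x == [set last c1 A; last d1 B]).
    have [e|n1] := eqVneq s1 s; last exact: (bd x s1).
    by apply: (bd x s2) => //; rewrite -e eq_sym.
  by rewrite !inE; case: (L1 == [::]); case: (L2 == [::]); rewrite ?inE //=; case: (x == _); rewrite ?orbT.
case/setUP.
  have [_|n1] := eqVneq L1 [::]; rewrite inE // => /eqP->.
  have [s' s'in xs'] := last_rung_in c d n1.
  apply: (sh _ s') => //; first exact: rung_ledges.
    by rewrite face_graphs_cat mem_cat s'in.
  apply/eqP => e; have [sv _] := face_graphs_sub s'in; rewrite e in sv.
  have := common_verts wf (subsetP sv _ vs) (subsetP sV _ vs).
  case/andP: wfF => /= /and3P[]; rewrite !inE negb_or cats0 => /andP[_ nc] nd _ _.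
  by rewrite -/c1 -/d1 => /orP[]/eqP ev; move: vAB; rewrite ev ?(negPf nc) ?(negPf nd).
case: L2 wf wf2 wfL2 sV memS bd sIn sh => [|[A2 B2] L2] wf wf2 wfL2 sV memS bd sIn sh; rewrite inE // => /eqP->.
pose s' := lgraph (last c1 A) (last d1 B) [:: (A2, B2)].
apply: (sh _ s'); [exact: face_last_rung | | |exact: rung_ledges].
  by rewrite face_graphs_cat mem_cat !inE eqxx !orbT.
apply/eqP => e; have wfF2 := (wf_cat (L := [:: (A2, B2)]) wfL2).1.
have [w wAB ws] := face_private wfF2.
have sv : vset s' \subset vset (lgraph (last c1 A) (last d1 B) ((A2, B2) :: L2)).
  by rewrite [lgraph _ _ (_ :: L2)]lgraph_cons subsetUl.
have ws' : w \in vset s by rewrite -e.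
have := @common_verts c1 d1 [:: (A, B)] _ w wf2 ws' (subsetP sv _ ws).
case/andP: wfF2 => /= /and3P[]; rewrite !inE negb_or cats0 => /andP[_ nc] nd _ _.
by rewrite /end1 /end2 /= => /orP[]/eqP ev; move: wAB; rewrite ev ?(negPf nc) ?(negPf nd).
Qed.

Definition interior L := behead (take (size L).-1 L).

(** In a single face, a matching that uses the left rung is forced along both sides; the ends of the
    right rung are left over exactly when the sides are odd. *)
Lemma face_kink c d L1 F L2 (c1 := end1 c L1) (d1 := end2 d L1) :
  wf_ladder c d (L1 ++ F :: L2) -> L1 != [::] -> L2 != [::] ->
  kink (face_graphs c d (L1 ++ F :: L2)) (lgraph c1 d1 [:: F]) = kinky F.
Proof.
move=> wf n1 n2; rewrite /kink shared_face // (negPf n1) (negPf n2) -/c1 -/d1.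
have wf1 : wf_ladder c1 d1 [:: F].
  by have := (wf_cat wf).2; rewrite -[F :: L2]cat1s => /wf_cat[].
set r := [set c1; d1]; set r' := [set last c1 F.1; last d1 F.2].
have nr : r != r'.
  apply: contraNneq (wf_rung wf1); rewrite /r => ->.
  by rewrite /= !inE eqxx !orbT.
have wf2 := wf_neq (wf_tail wf1).
have both M : lmatch c1 d1 [:: F] true M -> r \in M -> (r' \in M) = kinky F.
  move=> pM rM; have [_ _ pM'] := lmatch_cons wf1 pM.
  rewrite -/r rM /= in pM'; have := (lmatch_nil _ _ wf2).1 pM'.
  by move/setP/(_ r'); rewrite !inE eqxx andbT => ->; case: (kinky F); rewrite ?inE ?eqxx.
apply/idP/idP.
  case/exists_inP => x xr /exists_inP[y yr /andP[xy /existsP[M /and3P[pM xM yM]]]].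
  rewrite lgraph_pm in pM; have h : (r \in M) && (r' \in M).
    move: xr yr xy xM yM; rewrite !inE => /orP[]/eqP-> /orP[]/eqP-> //; rewrite ?eqxx //.
      by move=> _ -> ->.
    by move=> _ -> ->.
  by case/andP: h => rM; rewrite (both M pM rM).
move=> kF; have [[M [pM rM _]] _ _] := lower_bounds wf1.
apply/exists_inP; exists r; first by rewrite !inE eqxx.
apply/exists_inP; exists r'; first by rewrite !inE eqxx orbT.
rewrite nr; apply/existsP; exists M; rewrite lgraph_pm pM -/r in rM *.
by rewrite rM both.
Qed.

Lemma face_terminal c d L1 F L2 (c1 := end1 c L1) (d1 := end2 d L1) :
  wf_ladder c d (L1 ++ F :: L2) -> 1 < size (L1 ++ F :: L2) ->
  terminal (face_graphs c d (L1 ++ F :: L2)) (lgraph c1 d1 [:: F]) =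
    (L1 == [::]) || (L2 == [::]).
Proof.
move=> wf sz; rewrite /terminal shared_face // -/c1 -/d1.
have nb : ~~ ((L1 == [::]) && (L2 == [::])).
  by apply: contraTN sz => /andP[/eqP-> /eqP->].
have wf1 : wf_ladder c1 d1 [:: F].
  by have := (wf_cat wf).2; rewrite -[F :: L2]cat1s => /wf_cat[].
set r := [set c1; d1]; set r' := [set last c1 F.1; last d1 F.2].
have nr : r != r'.
  apply: contraNneq (wf_rung wf1); rewrite /r => ->.
  by rewrite /= !inE eqxx !orbT.
case: (L1 == [::]) nb; case: (L2 == [::]) => //= _.
- by rewrite set0U cards1.
- by rewrite setU0 cards1.
by rewrite cards2 nr.
Qed.

Lemma all_kinkE c d L : wf_ladder c d L -> L != [::] ->
  all_kink (face_graphs c d L) = all (@kinky T) (interior L).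
Proof.
move=> wf; case: L wf => [|F0 L] // wf _; rewrite /all_kink size_face_graphs.
(* A single face has no shared edge and is not [terminal], so the first disjunct of [all_kink]
   decides this case. *)
case/lastP: L wf => [|L Fl] wf; first by [].
have -> : interior (F0 :: rcons L Fl) = L.
  by rewrite /interior /= size_rcons /= -cats1 take_size_cat.
have sz : 1 < size (F0 :: rcons L Fl) by rewrite /= size_rcons.
have -> : (size (F0 :: rcons L Fl) == 1) = false by rewrite eqn_leq leqNgt sz.
rewrite orFb; apply/allP/allP => h.
  move=> F /splitPr FL; case: FL wf sz h => L1 L2 wf sz h.
  have e : F0 :: rcons (L1 ++ F :: L2) Fl = (F0 :: L1) ++ F :: rcons L2 Fl.
    by rewrite /= rcons_cat.
  rewrite e in h wf sz.
  have sin : lgraph (end1 c (F0 :: L1)) (end2 d (F0 :: L1)) [:: F] \in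
      face_graphs c d ((F0 :: L1) ++ F :: rcons L2 Fl).
    by rewrite face_graphs_cat mem_cat; apply/orP; right; apply: mem_head.
  have := h _ sin; rewrite face_terminal // face_kink //; last by case: (L2).
  have -> : (rcons L2 Fl == [::]) = false by case: (L2).
  by [].
move=> s sin.
have [L1 [F [L2 [e es]]]] := face_graphs_memP sin.
rewrite e es; rewrite e in wf sz.
rewrite face_terminal //; case: (eqVneq L1 [::]) => //= n1; case: (eqVneq L2 [::]) => //= n2.
rewrite face_kink //; apply: h; case: L1 n1 e {wf sz es} => // F1 L1 _ [_ e].
case/lastP: L2 n2 e => // L2 F2 _; rewrite -rcons_cons -rcons_cat => /rcons_inj[-> _].
by rewrite mem_cat mem_head orbT.
Qed.

Lemma tnum_maximal L j : j <= size L -> all (@kinky T) (take j.-1 L) ->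
  j = size L \/ ~~ all (@kinky T) (take j L) -> tnum L = j + hnum (drop j L).
Proof.
elim: L j => [|F L IH] [|j] //.
  by move=> _ _ [].
rewrite tnum_cons ltnS addSn => jL aj ej; congr _.+1.
case: j jL aj ej => [|j] jL aj ej /=.
  rewrite drop0; case: ej => [[/esym/size0nil->]|]; first by case: ifP.
  by rewrite /= take0 /= andbT => /negPf->.
move: aj ej; rewrite /= => /andP[kF aj]; rewrite kF /= => ej.
by apply: IH => //; case: ej => [[->]|]; [left | right].
Qed.

Lemma interior_take F L j : j <= size L -> interior (take j.+1 (F :: L)) = take j.-1 L.
Proof.
move=> jL; rewrite /interior /= size_takel //.
by case: j jL => [|k] kL /=; rewrite ?take0 // take_takel.
Qed.

(** The left end of the subchain is terminal too, in agreement with [gnum_cons], which adds one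
    whatever the kind of the first face. *)
Lemma gnum_maximal c d L i : wf_ladder c d L -> L != [::] ->
  first_maximal_all_kink (face_graphs c d L) i -> gnum L = i + hnum (drop i L).
Proof.
case: L => // F L wf _ [/andP[i0 il]]; rewrite size_face_graphs in il *.
case: i i0 il => // j _; rewrite ltnS => jL.
rewrite !take_face_graphs all_kinkE ?wf_take // interior_take // => aj ej.
rewrite gnum_cons addSn; congr _.+1; apply: tnum_maximal => //.
have [/eqP|lt] := boolP (j == size L); [by left | right].
have {}lt : j < size L by rewrite ltn_neqAle lt.
case: ej => [[e]|]; first by rewrite e ltnn in lt.
by rewrite all_kinkE ?wf_take // interior_take.
Qed.

Lemma del_ladder c d L i : wf_ladder c d L -> 0 < i <= size L ->
  del_vertices (lgraph c d L) (vset (lgraph c d (take i L))) =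
  rest (end1 c (take i L)) (end2 d (take i L)) (drop i L).
Proof.
elim: L c d i => [|[A B] L IH] c d [|i] wf iL //.
have wfL := wf_tail wf.
rewrite (del_sides wf); first last.
- by move=> v /mem_belast; rewrite inE /= !inE !mem_cat => /orP[]->; rewrite ?orbT.
- by move=> v /mem_belast; rewrite inE /= !inE !mem_cat => /orP[]->; rewrite ?orbT.
- by rewrite inE mem_head.
have la := mem_last c A; have lb := mem_last d B.
have sR v : v \in lverts (take i L) -> v \in vset (lgraph c d (take i.+1 ((A, B) :: L))).
  by move=> h; rewrite inE /= !inE !mem_cat h !orbT.
have sl : last c A \in vset (lgraph c d (take i.+1 ((A, B) :: L))).
  by move: la; rewrite inE /= !inE !mem_cat => /orP[]->; rewrite ?orbT.
have sl' : last d B \in vset (lgraph c d (take i.+1 ((A, B) :: L))).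
  by move: lb; rewrite inE /= !inE !mem_cat => /orP[]->; rewrite ?orbT.
have common v : v \in vset (lgraph (last c A) (last d B) L) ->
    (v \in vset (lgraph c d (take i.+1 ((A, B) :: L)))) =
    (v \in last c A :: last d B :: lverts (take i L)).
  move=> vL; apply/idP/idP => [h|]; last by rewrite 2!in_cons => /or3P[/eqP->|/eqP->|/sR].
  have := @common_verts c d [:: (A, B)] L v wf; rewrite /end1 /end2 /=.
  have [hF|hF] := boolP (v \in vset (lgraph c d [:: (A, B)])).
    by move/(_ isT vL); rewrite !inE => /orP[]->; rewrite ?orbT.
  move=> _; move: h hF; rewrite !inE /= !mem_cat.
  by case: (v \in lverts _); rewrite ?orbT // ?orbF => ->.
case: i iL sR sl sl' common => [|i] iL sR sl sl' common.
  rewrite /= take0 drop0; apply: del_vertices_eq; first exact: eset_lgraph.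
  by move=> v vL; have := common v vL; rewrite /= !take0 => ->; rewrite !inE.
rewrite -[RHS]/(rest (end1 (last c A) (take i.+1 L)) (end2 (last d B) (take i.+1 L)) (drop i.+1 L)).
rewrite -(IH (last c A) (last d B) i.+1) //.
by apply: del_vertices_eq; [exact: eset_lgraph | move=> v vL; rewrite common // in_set].
Qed.

(** Every face contributes a vertex, so the number of vertices determines a position in the
    ladder. *)
Lemma lverts_drop L i j : all (@even_face T) L -> i < j -> j <= size L ->
  size (lverts (drop j L)) < size (lverts (drop i L)).
Proof.
move=> eL ij jL; have -> : drop i L = take (j - i) (drop i L) ++ drop j L.
  by rewrite -{2}(subnK (ltnW ij)) -drop_drop cat_take_drop.
rewrite lverts_cat size_cat -[X in X < _]add0n ltn_add2r.
have : all (@even_face T) (take (j - i) (drop i L)).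
  by apply/allP => F /mem_take/mem_drop; apply: (allP eL).
case E : (take _ _) => [|F L'] /=; last first.
  by case/andP => /andP[_ pos] _; rewrite catA size_cat size_cat addn_gt0 pos.
have := congr1 size E; rewrite size_takel ?size_drop; last by apply: leq_sub2r.
by move/eqP; rewrite subn_eq0 leqNgt ij.
Qed.

Theorem decomposition_sum c d L Bs : wf_ladder c d L -> L != [::] ->
  all_kink_decomposition (lgraph c d L) (face_graphs c d L) Bs ->
  \sum_(B <- Bs) cyclomatic B = gnum L.
Proof.
move=> + + dec; move: dec.
move eH : (lgraph c d L) => H; move es : (face_graphs c d L) => s dec.
elim: dec c d L eH es => {H s Bs} [H s i fm om|H s i k K Bs fm om K0 eK dec IH] c d L eH es wf L0.
  subst H s; rewrite big_seq1.
  have gi := gnum_maximal wf L0 fm; have [i0 _ _] := fm; rewrite size_face_graphs in i0.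
  have t0 : take i L != [::] by rewrite -size_eq0 size_takel; case/andP: i0 => //; case: (i).
  move: om; rewrite take_face_graphs union_face_graphs // => -[_ _].
  rewrite del_ladder // => sE; rewrite cyclomatic_ladder ?wf_take // size_takel; last by case/andP: i0.
  have wfd := wf_drop i wf.
  have [K sK hK] := strips_rest wfd.
  have eK := strips_unique (closed_del (@eset_lgraph _ _ _ _)) (rest_matchable wfd) sK sE.
  rewrite gi; case: hK => [[_ ->]|[j jl [eK' _]]]; first by rewrite addn0.
  (* A nonempty remainder is a ladder and contains the ends of its first rung. *)
  have /setP/(_ (end1 (end1 c (take i L)) (take j (drop i L)))) : vset K = set0 by rewrite eK.
  by rewrite eK' !inE eqxx.
subst H s; rewrite big_cons.
have gi := gnum_maximal wf L0 fm; have [i0 _ _] := fm; rewrite size_face_graphs in i0.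
have t0 : take i L != [::] by rewrite -size_eq0 size_takel; case/andP: i0 => //; case: (i).
move: om; rewrite take_face_graphs union_face_graphs // => -[_ _].
rewrite del_ladder // => sE; rewrite cyclomatic_ladder ?wf_take // size_takel; last by case/andP: i0.
have wfd := wf_drop i wf.
have [K' sK hK] := strips_rest wfd.
have eK1 := strips_unique (closed_del (@eset_lgraph _ _ _ _)) (rest_matchable wfd) sK sE.
rewrite gi; congr (_ + _).
case: hK => [[eK' _]|[j jl [eK' hj]]]; first by rewrite -eK1 eK' eqxx in K0.
have kL : k < size L.
  rewrite ltnNge; apply: contra K0 => h; rewrite eK drop_oversize ?size_face_graphs //.
  by rewrite /union_graph !big_nil.
have dk0 : drop k L != [::] by rewrite -size_eq0 size_drop subn_eq0 -ltnNge.
rewrite drop_face_graphs union_face_graphs // in eK.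
(* The index [k] is known only through the graph that it leaves; comparing numbers of vertices
   identifies it with [i + j]. *)
have eS : size (lverts (drop k L)) = size (lverts (drop j (drop i L))).
  have wfk := wf_drop k wf; have wfj := wf_drop j wfd.
  have : vset K = vset K' by rewrite eK1.
  rewrite {1}eK eK' => /(congr1 (fun A : {set T} => #|A|)); rewrite !cardsE.
  by case/andP: wfk => /card_uniqP-> _; case/andP: wfj => /card_uniqP-> _ [].
have ekj : k = i + j.
  rewrite drop_drop addnC in eS; have eL : all (@even_face T) L by case/andP: wf.
  move: jl; rewrite size_drop ltn_subRL => jl.
  by case: (ltngtP k (i + j)) => // lt; [have := lverts_drop eL lt (ltnW jl) | have := lverts_drop eL lt (ltnW kL)];
    rewrite eS ltnn.
rewrite hj drop_drop addnC -ekj.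
apply: (IH (end1 c (take k L)) (end2 d (take k L)) (drop k L)) => //.
- by rewrite drop_face_graphs.
exact: wf_drop.
Qed.

End Decomposition.

(** * Outerplane graphs *)

(* [X] is the set of nodes and [Z] the set of links; connectedness is stated by cuts. *)
Lemma leq_nodes_links (N Y : finType) (X : {set N}) (Z : {set Y}) (s t : Y -> N) r :
  r \in X -> {in Z, forall y, s y \in X /\ t y \in X} ->
  (forall A : {set N}, A \subset X -> r \in A ->
     {in Z, forall y, (s y \in A) = (t y \in A)} -> X \subset A) ->
  #|X| <= #|Z|.+1.
Proof.
move=> rX endX cut.
(* A spanning tree is grown from [r]: while some link has exactly one end in [A], its other end
   joins [A], and the links inside [A] increase by at least one. *)
suff grow n (A : {set N}) : #|X :\: A| <= n -> A \subset X -> r \in A ->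
    #|A| <= #|[set y in Z | (s y \in A) && (t y \in A)]|.+1 -> #|X| <= #|Z|.+1.
  apply: (grow #|X| [set r]); rewrite ?sub1set ?set11 ?cards1 //.
  exact: subset_leq_card (subsetDl _ _).
elim: n A => [|n IH] A lA sA rA cA.
  have : X \subset A by move: lA; rewrite leqn0 cards_eq0 setD_eq0.
  move/subset_leq_card/leq_trans; apply; apply: leq_trans cA _; rewrite ltnS.
  by apply: subset_leq_card; apply/subsetP => y; rewrite inE => /andP[].
case: (boolP [forall (y | y \in Z), (s y \in A) == (t y \in A)]) => [/forall_inP h|].
  have := cut A sA rA (fun y yZ => eqP (h y yZ)).
  move/subset_leq_card/leq_trans; apply; apply: leq_trans cA _; rewrite ltnS.
  by apply: subset_leq_card; apply/subsetP => y; rewrite inE => /andP[].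
rewrite negb_forall_in => /exists_inP[y yZ yA].
have [v [vX vA ys yt]] : exists v, [/\ v \in X, v \notin A, s y \in v |: A & t y \in v |: A].
  have [sX tX] := endX y yZ; move: yA; case: (boolP (s y \in A)) => ys; case: (boolP (t y \in A)) => yt //= _.
    by exists (t y); rewrite !inE eqxx ys orbT.
  by exists (s y); rewrite !inE eqxx yt orbT.
apply: (IH (v |: A)).
- rewrite -ltnS; apply: leq_trans lA; apply: proper_card; apply/properP; split.
    by apply: setDS; apply: subsetUr.
  by exists v; rewrite !inE ?eqxx ?vX ?vA.
- by rewrite subUset sub1set vX.
- by rewrite inE rA orbT.
rewrite cardsU1 vA add1n ltnS; apply: leq_trans cA _; apply: proper_card.
apply/properP; split.
  by apply/subsetP => z; rewrite !inE => /and3P[-> -> ->]; rewrite !orbT.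
exists y; first by rewrite inE yZ ys.
by rewrite inE yZ /=; apply: contra yA => /andP[-> ->].
Qed.

Section MapAxioms.
Variable G : plane_graph.

Lemma adj_sym : symmetric (@adj G).
Proof. by case: G. Qed.
Lemma adj_irr : irreflexive (@adj G).
Proof. by case: G. Qed.
Lemma adj_connect (u v : G) : connect (@adj G) u v.
Proof. by case: G u v. Qed.
Lemma rot_adj (v u : G) : adj v u -> adj v (Defs.rot v u).
Proof. by case: G v u. Qed.
Lemma rot_connect (v u w : G) : adj v u -> adj v w -> fconnect (Defs.rot v) u w.
Proof. by case: G v u w. Qed.
Lemma euler : #|G| + #|faces (@adj G) (@Defs.rot G)| = #|edges (@adj G)| + 2.
Proof. by case: G. Qed.
Lemma ext_face : exterior G \in faces (@adj G) (@Defs.rot G).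
Proof. by case: G. Qed.
End MapAxioms.

(** * Darts, edges and faces of a combinatorial map *)

Section Maps.
Variable G : plane_graph.
Implicit Types (u v w : G) (d : G * G) (f : {set G * G}) (x : {set G}).

Local Notation e := (@adj G).
Local Notation rt := (@Defs.rot G).
Local Notation D := (darts (@adj G)).
Local Notation fs := (face_step (@Defs.rot G)).
Local Notation face := (face_of (@Defs.rot G)).
Local Notation ext := (exterior G).
Local Notation E := (edges (@adj G)).

Definition edge d : {set G} := [set d.1; d.2].

Lemma dartE d : (d \in D) = e d.1 d.2. Proof. by rewrite inE. Qed.

Lemma adj_neq u v : e u v -> u != v.
Proof. by apply: contraTneq => ->; rewrite adj_irr. Qed.

Lemma fs_dart : {homo fs : d / d \in D}.
Proof. by move=> d; rewrite !dartE /= => h; apply: rot_adj; rewrite adj_sym. Qed.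

Lemma rot_iter u v k : e v u -> e v (iter k (@Defs.rot G v) u).
Proof. by move=> h; elim: k => //= k; apply: rot_adj. Qed.

(** By transitivity every neighbour is reached from its own successor, so [rot v] maps the finite
    set of neighbours onto itself. *)
Lemma rot_inj v : {in e v &, injective (@Defs.rot G v)}.
Proof.
pose N := [set u | e v u].
have sN : @Defs.rot G v @: N = N.
  apply/setP => u; apply/imsetP/idP => [[z]|]; rewrite inE => h.
    by move=> ->; rewrite inE rot_adj.
  have := rot_connect (rot_adj h) h => /iter_findex h'.
  exists (iter (findex (@Defs.rot G v) (Defs.rot v u) u) (@Defs.rot G v) u); first by rewrite inE rot_iter.
  by rewrite -iterS iterSr.
have /imset_injP injN : #|@Defs.rot G v @: N| == #|N| by rewrite sN.
by move=> u w vu vw; apply: injN; rewrite inE.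
Qed.

Lemma fs_inj : {in D &, injective fs}.
Proof.
move=> [a b] [a' b']; rewrite !dartE /= => h h' [eb er]; rewrite -{b'}eb in h' er *.
by rewrite (@rot_inj b a a') // [_ \in _]adj_sym.
Qed.

Lemma face_self d : d \in face d. Proof. by rewrite inE connect0. Qed.

Lemma face_sub d d' : d \in D -> d' \in face d -> d' \in D.
Proof. by move=> dD; rewrite inE => /iter_findex <-; apply: iter_in => //; apply: fs_dart. Qed.

Lemma face_eq d d' : d \in D -> d' \in face d -> face d' = face d.
Proof.
move=> dD dd'; have dD' := face_sub dD dd'; rewrite inE in dd'.
have sym := fconnect_sym_in fs_dart fs_inj.
apply/setP => z; rewrite !inE; apply/idP/idP; first exact: connect_trans.
by apply: connect_trans; rewrite sym.
Qed.

Lemma face_fs d : d \in D -> face (fs d) = face d.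
Proof. by move=> dD; apply: face_eq; rewrite // inE fconnect1. Qed.

Lemma ext_memE d : d \in D -> (d \in ext) = (face d == ext).
Proof.
move=> dD; apply/idP/eqP => [|<-]; last exact: face_self.
case/imsetP: (ext_face G) => d0 d0D ->; exact: face_eq.
Qed.

Lemma ext_sub d : d \in ext -> d \in D.
Proof. by case/imsetP: (ext_face G) => d0 d0D ->; apply: face_sub. Qed.

Lemma ext_fs d : d \in D -> (fs d \in ext) = (d \in ext).
Proof. by move=> dD; rewrite !ext_memE ?fs_dart // face_fs. Qed.

Lemma faces_face d : d \in D -> face d \in faces e (@Defs.rot G).
Proof. by move=> dD; apply: imset_f. Qed.

Lemma edge_rev d : edge (d.2, d.1) = edge d.
Proof. by rewrite /edge setUC. Qed.

Lemma edge_eq d d' : edge d = edge d' -> d = d' \/ d = (d'.2, d'.1).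
Proof.
case: d d' => [a b] [a' b'] /= h.
have := set21 a b; rewrite -[[set a; b]]/(edge (a, b)) h !inE => /orP[]/eqP ea.
  have := set22 a b; rewrite -[[set a; b]]/(edge (a, b)) h !inE => /orP[]/eqP eb; last by left; rewrite ea eb.
  by left; have := set22 a' b'; rewrite -[[set a'; b']]/(edge (a', b')) -h !inE ea eb orbb => /eqP->.
have := set22 a b; rewrite -[[set a; b]]/(edge (a, b)) h !inE => /orP[]/eqP eb; first by right; rewrite ea eb.
by right; have := set21 a' b'; rewrite -[[set a'; b']]/(edge (a', b')) -h !inE ea eb orbb => /eqP->.
Qed.

Lemma card_darts : #|D| = 2 * #|E|.
Proof.
rewrite -sum1_card (partition_big edge (mem E)) /=; last by move=> d dD; apply: imset_f.
rewrite mulnC -sum_nat_const; apply: eq_bigr => x /imsetP[d dD ->].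
rewrite sum1_card -/(edge d).
have ne : d != (d.2, d.1).
  apply: contraTneq dD => h; rewrite dartE {1}h /= ; move: h; case: d => a b [-> _] /=.
  by rewrite adj_irr.
transitivity #|[set d; (d.2, d.1)]|; last by rewrite cards2 ne.
apply: eq_card => d'; rewrite [LHS]unfold_in in_set2; apply/andP/orP => [[_ /eqP/edge_eq[]->]|].
- by left.
- by right.
by case=> /eqP->; rewrite ?edge_rev eqxx; split=> //; rewrite dartE adj_sym -dartE.
Qed.

Definition inner := faces e (@Defs.rot G) :\ ext.

Lemma card_inner : #|G| + #|inner| = #|E| + 1.
Proof. by have := euler G; rewrite (cardsD1 ext (faces e rt)) ext_face add1n addnS addn2 addn1 => -[]. Qed.

Lemma inner_face d : d \in D -> (face d \in inner) = (d \notin ext).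
Proof. by move=> dD; rewrite !inE faces_face // andbT ext_memE. Qed.

Lemma innerP f : reflect (exists2 d, d \in D :\: ext & f = face d) (f \in inner).
Proof.
apply: (iffP idP) => [|[d]].
  move=> fi; have := fi; rewrite in_setD1 => /andP[_ /imsetP[d dD ef]].
  by exists d; rewrite // inE dD andbT -inner_face // -ef.
by rewrite inE => /andP[dx dD] ->; rewrite inner_face.
Qed.

End Maps.

(** * The incidence tree of inner faces and edges *)

Section Outerplane.
Variable G : plane_graph.
Implicit Types (u v w : G) (d : G * G) (f : {set G * G}) (x : {set G}).

Local Notation e := (@adj G).
Local Notation rt := (@Defs.rot G).
Local Notation D := (darts (@adj G)).
Local Notation fs := (face_step (@Defs.rot G)).
Local Notation face := (face_of (@Defs.rot G)).
Local Notation ext := (exterior G).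
Local Notation E := (edges (@adj G)).

Hypothesis conn2 : two_connected G.
Hypothesis outer : outerplane G.

Definition node : finType := (({set G * G} + {set G}) + G)%type.
Definition fnode f : node := inl (inl f).
Definition enode x : node := inl (inr x).
Definition vnode v : node := inr v.

Lemma fnode_inj : injective fnode. Proof. by move=> ? ? []. Qed.
Lemma enode_inj : injective enode. Proof. by move=> ? ? []. Qed.
Lemma vnode_inj : injective vnode. Proof. by move=> ? ? []. Qed.

Lemma ext_dart v : exists2 z, e v z & (v, z) \in ext.
Proof.
have [[a z] dx /= <-] := outer v; exists z => //.
by have := ext_sub dx; rewrite dartE.
Qed.

Lemma edge_mem u v : e u v -> [set u; v] \in E.
Proof. by move=> uv; apply/imsetP; exists (u, v); rewrite ?dartE. Qed.

Lemma third u v : exists2 w, w != u & w != v.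
Proof.
have [c3 _] := conn2; have : [set u; v] \proper [set: G].
  rewrite properEcard subsetT cardsT; apply: leq_ltn_trans c3.
  by rewrite cards2; case: (_ != _).
by case/properP => _ [w _]; rewrite !inE negb_or => /andP[]; exists w.
Qed.

Lemma around v z u : e v z -> e v u -> exists2 k, k < order (rt v) z & u = iter k (rt v) z.
Proof.
move=> vz vu; have c := rot_connect vz vu.
by exists (findex (rt v) z u); [apply: findex_max | rewrite iter_findex].
Qed.

(** The corner at [v] between two consecutive edges lies in one face, which enters along one edge
    and leaves along the other. An inner corner thus connects the two edges through a face node. *)
Lemma corner_face v u : e v u -> (v, rt v u) \notin ext ->
  [/\ (u, v) \in D :\: ext, (v, rt v u) \in D :\: ext & face (u, v) = face (v, rt v u)].
Proof.
move=> vu nx; have uD : (u, v) \in D by rewrite dartE adj_sym.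
rewrite -[(v, rt v u)]/(fs (u, v)) in nx *; rewrite !in_setD nx fs_dart // uD !andbT.
by rewrite -(ext_fs uD) nx face_fs.
Qed.

(* The nodes are the inner faces, the edges and the vertices other than [w]. An
   inner dart links its face to its edge, an exterior one its source to its edge.
   Turning around a vertex [v <> w] shows that all the edges at [v] are connected
   to [v], so that the whole graph is connected because [G - w] is; Euler's formula
   then leaves room for one exterior dart at [w] only. *)
Lemma ext_le1 w : #|[set d in ext | d.1 == w]| <= 1.
Proof.
pose Z := D :\: [set d in ext | d.1 == w].
pose X : {set node} := [set fnode f | f in inner G] :|: [set enode x | x in E] :|:
   [set vnode v | v in [set~ w]].
pose s d : node := if d \in ext then vnode d.1 else fnode (face d).
pose t d : node := enode (edge d).
have [v0 v0w _] := third w w.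
have eX d : d \in D -> enode (edge d) \in X.
  by move=> dD; rewrite !inE; apply/orP; left; apply/orP; right; do 2!apply: imset_f.
have vX v : (vnode v \in X) = (v != w).
  apply/idP/idP => [|vw]; last by rewrite !inE (imset_f vnode) ?orbT // !inE.
  by case/setUP => [/setUP[]/imsetP[]//|/imsetP[v' + [->]]]; rewrite !inE.
have fX f : f \in inner G -> fnode f \in X.
  by move=> fi; rewrite !inE (imset_f fnode).
have cX : #|X| = #|inner G| + #|E| + #|G|.-1.
  rewrite /X !cardsU; set a := #|_ :&: _|; set b := #|_ :&: _|.
  have -> : b = 0.
    by apply: eq_card0 => z; rewrite inE; apply/negP => /andP[/setUP[]/imsetP[? _ ->] /imsetP[]].
  have -> : a = 0.
    by apply: eq_card0 => z; rewrite inE; apply/negP => /andP[/imsetP[? _ ->] /imsetP[]].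
  by rewrite !subn0 (card_imset _ fnode_inj) (card_imset _ enode_inj) (card_imset _ vnode_inj) cardsC1.
have endX d : d \in Z -> s d \in X /\ t d \in X.
  rewrite in_setD inE => /andP[nd dD]; split; last exact: eX.
  rewrite /s; case: (boolP (d \in ext)) nd => [dx /= nd|dx _]; first by rewrite vX.
  by apply: fX; rewrite inner_face.
(* By Euler's formula there are exactly twice as many nodes as edges of the graph, that is, as many
   as darts; the links are the darts other than the exterior ones at [w]. *)
suff: #|X| <= #|Z|.+1.
  have cZ : #|Z| + #|[set d in ext | d.1 == w]| = 2 * #|E|.
    rewrite -card_darts addnC -(cardsID [set d in ext | d.1 == w] D); congr (_ + _).
    by apply: eq_card => d; rewrite !inE; case: (boolP (d \in ext)) => [/ext_sub|]; rewrite ?andbF ?inE // => ->.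
  have := card_inner G; have := conn2.1; rewrite cX; lia.
apply: (leq_nodes_links (r := vnode v0) _ endX); first by rewrite vX.
move=> A sA v0A cl.
have clx v z : v != w -> (v, z) \in ext -> (vnode v \in A) = (enode [set v; z] \in A).
  move=> vw vx; have := cl (v, z); rewrite /s vx; apply.
  by rewrite in_setD inE vx /= vw ext_sub.
have cli d : d \in D :\: ext -> (fnode (face d) \in A) = (enode (edge d) \in A).
  rewrite in_setD => /andP[dx dD]; have := cl d; rewrite /s (negPf dx); apply.
  by rewrite in_setD inE (negPf dx) dD.
have star v u : v != w -> e v u -> (enode [set v; u] \in A) = (vnode v \in A).
  move=> vw vu; have [z vz zx] := ext_dart v; have [k _ ->] := around vz vu.
  elim: k => [|k IH] /=; first by rewrite -clx.
  have vuk := rot_iter k vz.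
  case: (boolP ((v, rt v (iter k (rt v) z)) \in ext)) => [|/(corner_face vuk)[h1 h2 h3]].
    by move/(clx _ _ vw).
  by rewrite -IH -(cli _ h2) -h3 (cli _ h1) /edge /= setUC.
have allv v : v != w -> vnode v \in A.
  move=> vw; have [p] := connectP (conn2.2 w v0 v v0w vw).
  elim: p v0 v0A {v0w} => [|a p IH] b bA /=; first by move=> _ ->.
  case/andP=> /and3P[ba bw aw] pth lst; apply: (IH a) => //.
  by rewrite -(star a b) // 1?adj_sym // setUC star.
have alle d : d \in D -> enode (edge d) \in A.
  case: d => a b; rewrite dartE /edge /= => ab; have [ew|nw] := eqVneq a w; last by rewrite star ?allv.
  have bw : b != w by rewrite -ew eq_sym adj_neq.
  by rewrite setUC star ?allv // adj_sym.
apply/subsetP => z /setUP[/setUP[]|] /imsetP.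
- by case=> f /innerP[d dD ->] ->; rewrite cli //; apply: alle; case/setDP: dD.
- by case=> x /imsetP[d dD ->] ->; apply: alle.
by case=> v; rewrite !inE => vw ->; apply: allv.
Qed.

Lemma ext_uniq v z z' : (v, z) \in ext -> (v, z') \in ext -> z = z'.
Proof.
move=> h h'; have /card_le1_eqP := ext_le1 v.
by move/(_ (v, z) (v, z')); rewrite !inE h h' eqxx => /(_ isT isT)[].
Qed.

Lemma card_ext : #|ext| = #|G|.
Proof.
rewrite -sum1_card (partition_big (fun d => d.1) predT) //= -sum1_card.
apply: eq_bigr => v _; rewrite sum1_card; apply/eqP; rewrite eqn_leq.
have -> : #|[pred d in ext | d.1 == v]| = #|[set d in ext | d.1 == v]|.
  by apply: eq_card => d; rewrite !inE.
rewrite ext_le1; have [z _ zx] := ext_dart v; apply/card_gt0P.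
by exists (v, z); rewrite inE zx /=.
Qed.

Definition dual_nodes : {set node} := [set fnode f | f in inner G] :|: [set enode x | x in E].

Lemma fnode_dual f : (fnode f \in dual_nodes) = (f \in inner G).
Proof.
apply/idP/idP => [/setUP[]/imsetP[] // f' ? [->] //|fi].
by rewrite !inE (imset_f fnode).
Qed.

Lemma enode_dual x : (enode x \in dual_nodes) = (x \in E).
Proof.
apply/idP/idP => [/setUP[]/imsetP[] // f' ? [->] //|fi].
by rewrite !inE (imset_f enode) ?orbT.
Qed.

Lemma card_dual : #|dual_nodes| = (#|D :\: ext|).+1.
Proof.
rewrite /dual_nodes cardsU; set a := #|_ :&: _|.
have -> : a = 0.
  by apply: eq_card0 => z; rewrite inE; apply/negP => /andP[/imsetP[? _ ->] /imsetP[]].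
rewrite subn0 (card_imset _ fnode_inj) (card_imset _ enode_inj).
have := card_inner G; have := card_darts G; have := card_ext.
rewrite -(cardsID ext D); have -> : D :&: ext = ext by apply/setIidPr/subsetP => d /ext_sub.
clear; move: #|inner G| #|edges _| #|ext| #|D :\: ext| => n1 n2 n3 n4; lia.
Qed.

(** Connectedness of the incidence graph. Only one exterior dart starts at each vertex, so turning
    around the vertex from there passes inner corners only and connects all its edges; connectedness
    of the graph itself does the rest. *)
Lemma dual_cut (A : {set node}) d0 : d0 \in D -> enode (edge d0) \in A ->
  {in D :\: ext, forall d, (fnode (face d) \in A) = (enode (edge d) \in A)} ->
  dual_nodes \subset A.
Proof.
case: d0 => a0 b0; rewrite dartE => ab0 A0 cli.
have star v u u' : e v u -> e v u' -> (enode [set v; u] \in A) = (enode [set v; u'] \in A).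
  have [z vz zx] := ext_dart v.
  suff h w : e v w -> (enode [set v; w] \in A) = (enode [set v; z] \in A) by move=> /h-> /h->.
  move=> vw; have [k _ ->] := around vz vw; elim: k => //= k IH; have vuk := rot_iter k vz.
  case: (boolP ((v, rt v (iter k (rt v) z)) \in ext)) => [|/(corner_face vuk)[h1 h2 h3]].
    by move/ext_uniq/(_ zx) ->.
  by rewrite -IH -(cli _ h2) -h3 (cli _ h1) /edge /= setUC.
have allv v u : e v u -> enode [set v; u] \in A.
  have [p] := connectP (adj_connect a0 v).
  elim: p a0 b0 ab0 A0 => [|b p IH] a b0 ab0 A0 /=; first by move=> _ -> vu; rewrite (star a u b0).
  case/andP=> ab pth lst; apply: (IH b a) => //; first by rewrite adj_sym.
  by rewrite /edge /= setUC (star a b b0).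
have alle d : d \in D -> enode (edge d) \in A by rewrite dartE; apply: allv.
apply/subsetP => z /setUP[] /imsetP.
- by case=> f /innerP[d dD ->] ->; rewrite cli //; apply: alle; case/setDP: dD.
by case=> x /imsetP[d dD ->] ->; apply: alle.
Qed.

Lemma edge_inner d : d \in D -> (d \notin ext) || ((d.2, d.1) \notin ext).
Proof.
move=> dD; rewrite -negb_and; apply/negP => /andP[dx dx'].
have [w wd1 wd2] := third d.1 d.2; have [z wz _] := ext_dart w.
have : dual_nodes \subset [set enode (edge d)].
  apply: (dual_cut dD); first by rewrite inE.
  move=> d' /setDP[dD' nx]; rewrite !inE; symmetry; apply/negP => /eqP[] /edge_eq[] ed.
    by rewrite ed dx in nx.
  by rewrite ed dx' in nx.
move/subsetP/(_ (enode (edge (w, z)))); rewrite enode_dual edge_mem // => /(_ isT).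
by rewrite inE => /eqP[] /edge_eq[]/(congr1 fst)/= ew; [move: wd1 | move: wd2]; rewrite ew eqxx.
Qed.

(* Inner faces and edges form a tree under incidence, by [card_dual] and
   [dual_cut]. Two visits of [v] by the same inner face would close a cycle of
   this tree around [v], and one link could be dropped. *)
Lemma inner_simple d1 d2 : d1 \in D :\: ext -> d2 \in D :\: ext ->
  face d1 = face d2 -> d1.1 = d2.1 -> d1 = d2.
Proof.
case: d1 d2 => [v u1] [v2 u2] h1 h2 ef /= ev; rewrite -{v2}ev in h2 ef *.
have [z vz zx] := ext_dart v.
have e1 : e v u1 by move/setDP: (h1) => []; rewrite dartE.
have e2 : e v u2 by move/setDP: (h2) => []; rewrite dartE.
(* Positions are counted from the exterior dart at [v], so turning from one to a later one never
   crosses the exterior corner. *)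
have [a la ea] := around vz e1; have [b lb eb] := around vz e2.
wlog ab : a b u1 u2 h1 h2 ef e1 e2 la lb ea eb / a <= b.
  move=> W; case: (leqP a b) => [|/ltnW] ab; first exact: (W a b).
  by apply/esym; apply: (W b a).
case: (eqVneq a b) => [eab|nab]; first by rewrite ea eb eab.
have {nab} ltab : a < b by rewrite ltn_neqAle nab.
pose Z := D :\: ext :\ (v, u1).
pose s d := fnode (face d); pose t d := enode (edge d).
have : #|dual_nodes| <= #|Z|.+1.
  apply: (leq_nodes_links (s := s) (t := t) (r := enode (edge (v, u1)))).
  - by rewrite enode_dual edge_mem.
  - move=> d; rewrite !in_setD => /andP[_ /andP[dx dD]]; rewrite fnode_dual enode_dual inner_face //.
    by split=> //; apply: imset_f.
  move=> A _ A0 cl.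
  have cl' d : d \in D :\: ext -> d != (v, u1) -> (fnode (face d) \in A) = (enode (edge d) \in A).
    by move=> dD dn; apply: (cl d); rewrite in_setD1 dn.
  apply: (dual_cut (d0 := (v, u1)) _ A0); first by rewrite dartE.
  move=> d dD; have [->|] := eqVneq d (v, u1); last exact: cl'.
  have step k : a <= k -> k <= b -> (enode (edge (v, iter k (rt v) z)) \in A) = (enode (edge (v, u1)) \in A).
    elim: k => [|k IH] ak kb; first by move: ak; rewrite leqn0 => /eqP a0; rewrite ea a0.
    move: ak; rewrite leq_eqVlt => /orP[/eqP <-|]; first by rewrite ea.
    rewrite ltnS => ak; rewrite -IH ?(ltnW kb) // => {IH}; have vuk := rot_iter k vz.
    have ko : k.+1 < order (rt v) z by apply: leq_ltn_trans lb.
    have nz j : iter k.+1 (rt v) z = iter j (rt v) z -> j < order (rt v) z -> j = k.+1.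
      by move=> ej jo; rewrite -(findex_iter jo) -ej findex_iter.
    have nx : (v, iter k.+1 (rt v) z) \notin ext.
      by apply/negP => /ext_uniq/(_ zx) ez; have := nz 0 ez (order_gt0 _ _).
    have [k1 k2 k3] := corner_face vuk nx.
    have n1 : (iter k (rt v) z, v) != (v, u1).
      by apply: contraTneq vuk => -[-> _]; rewrite adj_irr.
    have n2 : (v, iter k.+1 (rt v) z) != (v, u1).
      apply/eqP => -[ek]; rewrite ea in ek; have := nz a ek la => ak'.
      by move: ak; rewrite ak' ltnn.
    by rewrite -(cl' _ k2 n2) -k3 (cl' _ k1 n1) -edge_rev.
  (* The dropped link is bypassed: its face is also the face of [(v, u2)], whose edge is reached
     from that of [(v, u1)] by turning around [v]. *)
  rewrite ef cl' //; last first.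
    apply/eqP => -[eu]; move: ltab; rewrite -(findex_iter la) -(findex_iter lb) -ea -eb eu ltnn.
    by [].
  by rewrite eb step // ltnW.
by rewrite card_dual /Z (cardsD1 (v, u1) (D :\: ext)) h1 add1n ltnn.
Qed.

End Outerplane.

(** * Cycles as ladders with one face *)

Section PathSplit.
Variable T : finType.
Implicit Types (a b u v : T) (s : seq T) (x y : {set T}).

Lemma path_edges_cat a s s' :
  path_edges a (s ++ s') = path_edges a s :|: path_edges (last a s) s'.
Proof. by elim: s a => [|b s IH] a /=; rewrite ?set0U // IH setUA. Qed.

Lemma path_edges_split a s y : y \in path_edges a s ->
  exists s1 u s2, s = s1 ++ u :: s2 /\ y = [set last a s1; u].
Proof.
elim: s a => [|b s IH] a /=; first by rewrite inE.
case/setU1P => [->|/IH[s1 [u [s2 [-> ->]]]]]; first by exists [::], b, s.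
by exists (b :: s1), u, s2.
Qed.

Lemma path_edges_rev u s : exists B,
  [/\ last u s :: B = rev (u :: s), path_edges (last u s) B = path_edges u s & last (last u s) B = u].
Proof.
elim/last_ind: s => [|s z [B [eB pB lB]]]; first by exists [::].
exists (last u s :: B); split.
- by rewrite last_rcons -rcons_cons rev_rcons eB.
- by rewrite last_rcons -cats1 path_edges_cat -pB /= setU0 setUC [[set z; _]]setUC.
by rewrite last_rcons /=.
Qed.

Lemma lgraph_swap a b (A B : seq T) : lgraph a b [:: (A, B)] = lgraph b a [:: (B, A)].
Proof.
congr pair.
  apply/setP => v; rewrite !inE /= !mem_cat in_nil !orbF.
  by case: (v == a); case: (v == b); case: (v \in A); case: (v \in B).
rewrite /= [[set b; a]]setUC [[set last b B; last a A]]setUC; congr (_ :|: _).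
by rewrite !setUA [path_edges b B :|: _]setUC.
Qed.

(** The closing edge of the cycle is the left rung, and the edge entering [u] becomes the right
    rung. The second side is the rest of the path read backwards from its end. *)
Lemma cycle_lgraph a s1 u s2 (s := s1 ++ u :: s2) : exists B,
  [/\ lgraph a (last a s) [:: (s1, B)] = ([set v in a :: s], [set last a s; a] |: path_edges a s),
      size B = size s2 & last (last a s) B = u].
Proof.
have [B [eB pB lB]] := path_edges_rev u s2.
have sB : size B = size s2 by have := congr1 size eB; rewrite size_rev /= => -[].
exists B; rewrite /s last_cat /=; split=> //.
congr pair.
  apply/setP => v; rewrite !inE /= !mem_cat in_nil orbF.
  have : (v \in last u s2 :: B) = (v \in u :: s2) by rewrite eB mem_rev.
  by rewrite !inE; case: (v == a); case: (v \in s1); rewrite /= ?orbT.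
rewrite /= lB path_edges_cat /= pB [[set a; _]]setUC; congr (_ :|: _).
by rewrite [path_edges u s2 :|: _]setUC.
Qed.

End PathSplit.

(** * From an outerplane chain to a ladder *)

Section Faces.
Variable G : plane_graph.
Implicit Types (u v w : G) (d : G * G) (f : {set G * G}) (x : {set G}).

Local Notation e := (@adj G).
Local Notation rt := (@Defs.rot G).
Local Notation D := (darts (@adj G)).
Local Notation fs := (face_step (@Defs.rot G)).
Local Notation face := (face_of (@Defs.rot G)).
Local Notation ext := (exterior G).
Local Notation E := (edges (@adj G)).

Hypothesis conn2 : two_connected G.
Hypothesis outer : outerplane G.

Lemma vset_boundary f v : (v \in vset (boundary f)) = [exists d in f, v == d.1].
Proof.
apply/imsetP/exists_inP => [[d df ->]|[d df /eqP->]]; first by exists d.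
by exists d.
Qed.

Lemma eset_boundaryP f x : reflect (exists2 d, d \in f & x = edge d) (x \in eset (boundary f)).
Proof. exact: imsetP. Qed.

Lemma path_edges_traject d k :
  path_edges d.1 [seq d'.1 | d' <- traject fs (fs d) k] =
  [set x in [seq edge d' | d' <- traject fs d k]].
Proof.
elim: k d => [|k IH] d; first by apply/setP => x; rewrite !inE.
rewrite [traject fs d k.+1]trajectS map_cons set_cons -IH.
by [].
Qed.

(** The walk runs from the head of [d] round to its tail, so that the edge of [d] closes it and can
    serve as a rung. *)
Lemma boundary_cycle d : d \in D -> exists s,
  [/\ last d.2 s = d.1, (size s).+1 = #|face d|,
      [seq d'.1 | d' <- orbit fs (fs d)] = d.2 :: s &
      boundary (face d) = ([set v in d.2 :: s], [set d.1; d.2] |: path_edges d.2 s)].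
Proof.
move=> dD; have dD' := fs_dart dD.
have [n on] : exists n, order fs (fs d) = n.+1 by exists (order fs (fs d)).-1; rewrite orderSpred.
have ord := iter_order_in (@fs_dart G) (@fs_inj G) dD'.
have eo : orbit fs (fs d) = rcons (traject fs (fs d) n) d.
  rewrite /orbit on trajectSr; congr (rcons _ _).
  apply: (@fs_inj G) => //; first by apply: iter_in => //; apply: fs_dart.
  by rewrite -iterS -on ord.
have memf d' : (d' \in face d) = (d' \in orbit fs (fs d)).
  by rewrite -(face_fs dD) inE fconnect_orbit.
exists [seq d'.1 | d' <- traject fs (fs (fs d)) n].
have ln : last d.2 [seq d'.1 | d' <- traject fs (fs (fs d)) n] = d.1.
  have -> : d.2 = (fs d).1 by [].
  rewrite last_map last_traject; have := congr1 (last d) eo.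
  by rewrite last_rcons /orbit on trajectS /= last_traject => ->.
split=> //.
- by rewrite size_map size_traject -on -(face_fs dD) /order; apply: eq_card => d'; rewrite [RHS]inE.
- by rewrite /orbit on.
congr pair.
  apply/setP => v; rewrite vset_boundary inE.
  have -> : d.2 :: [seq d'.1 | d' <- traject fs (fs (fs d)) n] = [seq d'.1 | d' <- orbit fs (fs d)].
    by rewrite /orbit on.
  apply/exists_inP/mapP => [[d' d'f /eqP->]|[d' d'o ->]]; exists d' => //; first by rewrite -memf.
  by rewrite memf.
rewrite -[in RHS](_ : (fs d).1 = d.2) // path_edges_traject.
apply/setP => x; apply/eset_boundaryP/idP.
  case=> d'; rewrite memf eo mem_rcons inE => /orP[/eqP->|h] ->; first by rewrite !inE eqxx.
  by rewrite !inE map_f ?orbT.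
case/setU1P => [->|]; first by exists d; rewrite ?face_self.
rewrite inE => /mapP[d' h ->]; exists d' => //.
by rewrite memf eo mem_rcons inE h orbT.
Qed.

Lemma inner_sources f : f \in inner G -> {in f &, injective (fun d => d.1)}.
Proof.
case/innerP => d /setDP[dD dx] -> d1 d2 h1 h2; apply: inner_simple => //.
- by rewrite in_setD (face_sub dD) // andbT ext_memE ?(face_sub dD) // (face_eq dD) // -ext_memE.
- by rewrite in_setD (face_sub dD) // andbT ext_memE ?(face_sub dD) // (face_eq dD) // -ext_memE.
by rewrite !(face_eq dD).
Qed.

(** Otherwise [a] would be the only neighbour of [b], and deleting [a] would separate [b] from a
    third vertex. *)
Lemma no_turn_back a b : e a b -> rt b a != a.
Proof.
move=> ab; apply/eqP => rba; have [w wa wb] := third conn2 a b.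
have ba : b != a by rewrite eq_sym adj_neq.
have [[|c p] /=] := connectP (conn2.2 a b w ba wa); first by move=> _ ew; rewrite ew eqxx in wb.
case/andP=> /and3P[bc _ ca] _ _; have eba : e b a by rewrite adj_sym.
have [k _ ek] := around eba bc.
have ia : iter k (rt b) a = a by elim: (k) => //= m ->.
by rewrite ek ia eqxx in ca.
Qed.

Lemma face_big d : d \in D -> 2 < #|face d|.
Proof.
case: d => a b; rewrite dartE /= => ab.
have sub : [set (a, b); fs (a, b); fs (fs (a, b))] \subset face (a, b).
  apply/subsetP => d; rewrite !inE => /orP[/orP[]|] /eqP->; first exact: connect0.
    exact: fconnect1.
  exact: (fconnect_iter _ 2).
apply: leq_trans (subset_leq_card sub); rewrite /face_step /= -setUA !cardsU1 cards1 !inE !xpair_eqE.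
have ba : e b a by rewrite adj_sym.
rewrite (negPf (adj_neq ab)) [a == rt b a]eq_sym (negPf (no_turn_back ab)).
by rewrite [b == rt b a](negbTE (adj_neq (rot_adj ba))).
Qed.

Lemma inner_cycle f : f \in inner G -> bounded_by_cycle f.
Proof.
move=> fi; rewrite /bounded_by_cycle (card_in_imset (inner_sources fi)) eqxx andbT.
by case/innerP: fi => d /setDP[dD _] ->; apply: face_big.
Qed.

Lemma face_cyclesE : face_cycles G = [set boundary f | f in inner G].
Proof.
apply/setP => s; apply/imsetP/imsetP => -[f].
  rewrite inE => /and3P[fF fx _] ->; exists f => //.
  by rewrite !inE fx.
move=> fi ->; exists f => //; rewrite inE inner_cycle // andbT.
by move: fi; rewrite !inE andbC.
Qed.

Lemma inner_dart f d : f \in inner G -> d \in f -> d \in D :\: ext /\ face d = f.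
Proof.
case/innerP => d0 /setDP[dD dx] -> df; have dD' := face_sub dD df.
by rewrite (face_eq dD df); split=> //; rewrite in_setD dD' ext_memE // (face_eq dD df) -ext_memE // dx.
Qed.

(** Two faces with the same boundary use both darts of each of its edges. The two faces and these
    edges are then closed under incidence, hence everything, and no dart is left for the exterior
    face. *)
Lemma boundary_inj : {in inner G &, injective (@boundary G)}.
Proof.
move=> f f' fi fi' eb; apply/eqP; apply: contraT => nf.
have eE x : (x \in eset (boundary f)) = (x \in eset (boundary f')) by rewrite eb.
have ff' d : d \in f -> d \notin f'.
  move=> df; apply/negP => df'; have [_ e1] := inner_dart fi df; have [_ e2] := inner_dart fi' df'.
  by rewrite -e1 e2 eqxx in nf.
have both d : edge d \in eset (boundary f) -> d \in f \/ d \in f'.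
  move=> h; have := h; rewrite eE => /eset_boundaryP[d2 h2 e2]; case/eset_boundaryP: h => d1 h1 e1.
  case: (edge_eq e1) => [->|e1']; first by left.
  case: (edge_eq e2) => [->|e2']; first by right.
  case/negP: (ff' d1 h1); suff -> : d1 = d2 by [].
  by move: e1'; rewrite e2' => -[] {e1 e2 e2'}; case: (d1) => a b; case: (d2) => a' b' /= -> ->.
have [d dD ed] : exists2 d, d \in D :\: ext & f = face d by apply/innerP.
have df : d \in f by rewrite ed face_self.
pose A := fnode f |: (fnode f' |: [set enode x | x in eset (boundary f)]).
have fA f0 : (fnode f0 \in A) = (f0 == f) || (f0 == f').
  rewrite !inE -!(inj_eq (@fnode_inj G)); case: (_ == _); case: (_ == _) => //=.
  by apply/negP => /imsetP[].
have eA x : (enode x \in A) = (x \in eset (boundary f)).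
  rewrite !inE /=; apply/imsetP/idP => [[y h [->]]//|h]; by exists x.
have: dual_nodes G \subset A.
  apply: (dual_cut conn2 outer (d0 := d)); first by case/setDP: dD.
    by rewrite eA; apply/eset_boundaryP; exists d.
  move=> d' /setDP[dD' nx]; rewrite fA eA; apply/orP/idP.
    case=> /eqP e'; last rewrite eE; apply/eset_boundaryP; exists d' => //; rewrite -e'; exact: face_self.
  by case/both => [/(inner_dart fi)[_ ->]|/(inner_dart fi')[_ ->]]; [left | right].
have [z vz zx] := ext_dart outer d.1.
move/subsetP/(_ (enode (edge (d.1, z)))); rewrite enode_dual edge_mem // eA => /(_ isT)/both[].
  by move/(inner_dart fi) => [/setDP[_ /negP]].
by move/(inner_dart fi') => [/setDP[_ /negP]].
Qed.

Lemma edge_two_faces f1 f2 f3 x : f1 \in inner G -> f2 \in inner G -> f3 \in inner G ->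
  x \in eset (boundary f1) -> x \in eset (boundary f2) -> x \in eset (boundary f3) ->
  [|| f1 == f2, f1 == f3 | f2 == f3].
Proof.
move=> i1 i2 i3 /eset_boundaryP[d1 h1 ->] /eset_boundaryP[d2 h2 e2] /eset_boundaryP[d3 h3 e3].
have [_ k1] := inner_dart i1 h1; have [_ k2] := inner_dart i2 h2; have [_ k3] := inner_dart i3 h3.
case: (edge_eq e2) => e2'; first by rewrite -k1 -k2 e2' eqxx.
case: (edge_eq e3) => e3'; first by rewrite -k1 -k3 e3' eqxx orbT.
have e23 : d2 = d3.
  by move: e2'; rewrite e3' => -[] {e2 e3 e3' h2 h3 k2 k3}; case: (d2) => a b; case: (d3) => a' b' /= -> ->.
by rewrite -k2 -k3 e23 eqxx !orbT.
Qed.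

Lemma card_inner_darts : \sum_(f in inner G) #|f| = #|D :\: ext|.
Proof.
rewrite -[RHS]sum1_card (partition_big face (mem (inner G))) /=; last first.
  by move=> d /setDP[dD dx]; rewrite inner_face.
apply: eq_bigr => f fi; rewrite sum1_card; apply: eq_card => d.
rewrite [RHS]unfold_in; apply/idP/andP => [/(inner_dart fi)[-> ->]|[_ /eqP<-]]; first by rewrite eqxx.
exact: face_self.
Qed.

Lemma card_vset_boundary f : f \in inner G -> #|vset (boundary f)| = #|f|.
Proof. by move=> fi; rewrite (card_in_imset (inner_sources fi)). Qed.

Lemma eset_boundary_sub f : f \in inner G -> eset (boundary f) \subset E.
Proof.
move=> fi; apply/subsetP => x /eset_boundaryP[d df ->]; apply: imset_f.
by have [/setDP[]] := inner_dart fi df.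
Qed.

Hypothesis bip : bipartite G.

Lemma inner_even f : f \in inner G -> ~~ odd #|f|.
Proof.
move=> fi; have [color cP] := bip; have sE := eset_boundary_sub fi.
case/innerP: fi sE => d /setDP[dD _] -> sE.
have [s [ls <- _ bf]] := boundary_cycle dD; rewrite /= negbK.
have col a b : [set a; b] \in E -> color a != color b.
  case/imsetP => d' d'D eab; have := d'D; rewrite dartE => /cP.
  by case: (@edge_eq G (a, b) d' eab) => [<-|] //; case: d' {d'D eab} => a' b' /= [-> ->]; rewrite eq_sym.
have path a t : path_edges a t \subset E -> color (last a t) = color a (+) odd (size t).
  elim: t a => [|b t IH] a /=; first by rewrite addbF.
  rewrite subUset sub1set => /andP[/col h /IH ->]; move: h.
  by case: (color a); case: (color b); case: odd.
have := path d.2 s; rewrite ls => h; have {}h := h _.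
have /h {}h : path_edges d.2 s \subset E.
  by apply: subset_trans sE; rewrite bf subsetUr.
have := col d.1 d.2; rewrite -[[set _; _]]/(edge d) imset_f // => /(_ isT); rewrite h.
by case: (color d.2); case: odd.
Qed.

Definition represents f a b F := [/\ boundary f = lgraph a b [:: F], even_face F
  & #|f| = (size F.1 + size F.2).+2].

(** The boundary is a path from [a] to [b] closed by the rung, and any edge of the path can be made
    the right rung. The second one leaves a first side of length one, which is odd; this choice
    serves for the last face. *)
Lemma represents_core f a b : f \in inner G -> (b, a) \in f ->
  (forall y, y \in eset (boundary f) -> y != [set a; b] ->
     exists2 F, represents f a b F & y = [set last a F.1; last b F.2]) /\
  (exists2 F, represents f a b F & kinky F).
Proof.
move=> fi bf; have ev := inner_even fi; have big := inner_cycle fi; case/andP: big => big _.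
have [/setDP[bD _] ef] := inner_dart fi bf.
have [s [ls cs _]] := boundary_cycle bD; rewrite ef /= in ls cs *; move=> eb.
have core s1 u s2 : s = s1 ++ u :: s2 -> exists2 B, represents f a b (s1, B) & last b B = u.
  move=> es; have [B []] := cycle_lgraph a s1 u s2; rewrite -es ls => lB sB uB.
  have cf : #|f| = (size s1 + size B).+2 by rewrite -cs es size_cat /= sB addnS.
  exists B => //; split=> //; first by rewrite eb lB.
  rewrite /even_face /=; apply/andP; split; first by move: ev; rewrite cf /= negbK.
  by move: big; rewrite cf.
split=> [y yf ny|].
  have : y \in path_edges a s.
    by move: (yf : y \in eset (boundary f)); rewrite eb => /setU1P[ey|//]; rewrite ey setUC eqxx in ny.
  case/path_edges_split => s1 [u [s2 [es ->]]]; have [B rB uB] := core _ _ _ es.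
  by exists (s1, B) => //=; rewrite uB.
case: s cs {ls eb} core => [|a1 [|u s]] cs core; try by rewrite -cs in big.
by have [B rB _] := core [:: a1] u s erefl; exists ([:: a1], B).
Qed.

Lemma represents_swap f a b A B : represents f b a (A, B) -> represents f a b (B, A).
Proof.
case=> h1 h2 h3; split; first by rewrite lgraph_swap.
  by move: h2; rewrite /even_face /= addnC.
by rewrite /= addnC.
Qed.

Lemma represents_ex f a b : f \in inner G -> [set a; b] \in eset (boundary f) ->
  (forall y, y \in eset (boundary f) -> y != [set a; b] ->
     exists2 F, represents f a b F & y = [set last a F.1; last b F.2]) /\
  (exists2 F, represents f a b F & kinky F).
Proof.
move=> fi /eset_boundaryP[[a' b'] df /(@edge_eq G (a, b))[] /= [ea eb]]; last first.
  by apply: represents_core => //; rewrite ea eb.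
rewrite -ea -eb in df; have [h1 [[A B] h2 kF]] := represents_core fi df; split.
  move=> y yf; rewrite setUC => ny; have [[A' B'] rF ->] := h1 y yf ny.
  by exists (B', A'); [apply: represents_swap | rewrite setUC].
exists (B, A); first exact: represents_swap.
move: kF; have [_ /andP[+ _] _] := h2; rewrite /kinky oddD /=.
by case: odd; case: odd.
Qed.

Definition inner_boundary s := exists2 f, f \in inner G & s = boundary f.

(** Distinctness of the vertices is not yet known: consecutive faces might still have further
    contacts. The sum over the faces, two vertices for the left rung of each and the rest from its
    sides, is recorded to settle this by counting. *)
Lemma build_ladder s (c : seq (graph G)) a b :
  {in s :: c, forall s', inner_boundary s'} -> uniq (s :: c) -> sorted (@adjacent G) (s :: c) ->
  [set a; b] \in eset s ->
  (forall s' c', c = s' :: c' -> exists2 y, y \in eset s :&: eset s' & y != [set a; b]) ->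
  exists L, [/\ face_graphs a b L = s :: c, all (@even_face G) L, last_kinky L
    & \sum_(s' <- s :: c) #|vset s'| = size (lverts L) + 2 * size L].
Proof.
elim: c s a b => [|s' c IH] s a b inn U srt ab next.
  have [f fi es] := inn s (mem_head _ _); rewrite es in ab *.
  have [_ [F [bF eF cF] kF]] := represents_ex fi ab.
  exists [:: F]; split; rewrite /= ?bF ?eF //.
  by rewrite big_seq1 -bF card_vset_boundary // cF cats0 size_cat; lia.
have [f fi es] := inn s (mem_head _ _).
have [y] := next _ _ erefl; rewrite inE => /andP[ys ys'] ny; rewrite es in ab ys.
have [h _] := represents_ex fi ab; have [F [bF eF cF] ey] := h y ys ny.
have inn' : {in s' :: c, forall s', inner_boundary s'}.
  by move=> t tc; apply: inn; rewrite inE tc orbT.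
have U' : uniq (s' :: c) by case/andP: U.
have srt' : sorted (@adjacent G) (s' :: c) by case/andP: srt.
have [|s'' c' ec|L [gL eL kL sL]] := IH s' (last a F.1) (last b F.2) inn' U' srt'.
- by rewrite -ey.
(* The edge shared with the next face differs from the rung just crossed, which would otherwise lie
   on three inner faces. *)
- rewrite ec /= in srt'; case/andP: srt' => /andP[_ /set0Pn[z zz]] _; exists z => //.
  rewrite -ey; apply/eqP => ezy; rewrite ezy inE in zz; case/andP: zz => _ zs''.
  have [f2 fi2 es2] := inn' s' (mem_head _ _).
  have s''c : s'' \in [:: s, s' & c] by rewrite ec !inE eqxx !orbT.
  have [f3 fi3 es3] := inn s'' s''c.
  rewrite es2 in ys'; rewrite es3 in zs''.
  have := edge_two_faces fi fi2 fi3 ys ys' zs''.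
  move: U; rewrite ec /= !inE !negb_or => /and3P[/and3P[n1 n2 _] /andP[n3 _] _].
  by case/or3P => /eqP ef; [move: n1 | move: n2 | move: n3]; rewrite ?es ?es2 ?es3 ef eqxx.
exists (F :: L); split.
- by rewrite /= gL es bF.
- by rewrite /= eF.
- by case: (L) gL kL.
rewrite big_cons sL es card_vset_boundary // cF /= !size_cat.
by move: (size F.1) (size F.2) (size (lverts L)) (size L); clear=> n1 n2 n3 n4; lia.
Qed.

Lemma union_eset (c : seq (graph G)) x : x \in eset (union_graph c) ->
  exists2 s, s \in c & x \in eset s.
Proof.
rewrite /union_graph /=; elim: c => [|s c IH]; first by rewrite big_nil inE.
rewrite big_cons => /setUP[|/IH[t tc xt]]; first by exists s; rewrite ?mem_head.
by exists t; rewrite // inE tc orbT.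
Qed.

Lemma chain_ladder c : left_to_right c -> exists a b L,
  [/\ wf_ladder a b L, last_kinky L, L != [::], graph_of G = lgraph a b L
    & c = face_graphs a b L].
Proof.
case=> U eC srt.
have inn : {in c, forall s, inner_boundary s}.
  by move=> s; rewrite eC face_cyclesE => /imsetP[f fi ->]; exists f.
have inC f : f \in inner G -> boundary f \in c.
  by move=> fi; rewrite eC face_cyclesE imset_f.
have sumC : \sum_(s <- c) #|vset s| = #|D :\: ext|.
  rewrite -card_inner_darts -(eq_bigr _ (fun f fi => card_vset_boundary fi)).
  rewrite -(big_imset (fun s => #|vset s|) boundary_inj) /= -face_cyclesE.
  rewrite -big_enum /=; apply: perm_big; apply: uniq_perm; rewrite ?enum_uniq //.
  by move=> s; rewrite mem_enum eC.
have sizeC : size c = #|inner G|.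
  by rewrite -(card_uniqP U) (eq_card eC) face_cyclesE (card_in_imset boundary_inj).
have edgeC x : x \in E -> exists2 s, s \in c & x \in eset s.
  case/imsetP => d dD ->; rewrite -/(edge d); have [d' dD' ->] : exists2 d', d' \in D :\: ext & edge d = edge d'.
    case/orP: (edge_inner conn2 outer dD) => nx; first by exists d; rewrite // in_setD nx.
    by exists (d.2, d.1); rewrite ?edge_rev // in_setD nx dartE adj_sym -dartE.
  exists (boundary (face d')); first by apply: inC; apply/innerP; exists d'.
  by apply/eset_boundaryP; exists d'; rewrite ?face_self.
case: c U eC srt inn inC sumC sizeC edgeC => [|s c] U eC srt inn inC sumC sizeC edgeC.
  have [v] : exists v : G, v \in [set: G].
    by apply/set0Pn; rewrite -card_gt0 cardsT; case: conn2 => /(leq_trans _) -> //.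
  by have [z vz _] := ext_dart outer v; have [] := edgeC _ (edge_mem vz).
(* The first rung may be any edge of the first face except the one chosen as shared with the
   second. *)
have [a [b [ab next]]] : exists a b, [set a; b] \in eset s /\
   (forall s' c', c = s' :: c' -> exists2 y, y \in eset s :&: eset s' & y != [set a; b]).
  have [f fi es] := inn s (mem_head _ _).
  have [d dD ef] : exists2 d, d \in D :\: ext & f = face d by apply/innerP.
  have df : d \in f by rewrite ef face_self.
  case: c srt {U eC inn inC sumC sizeC edgeC} => [|s' c] srt.
    by exists d.1, d.2; split=> //; rewrite es; apply/eset_boundaryP; exists d.
  case/andP: srt => /andP[_ /set0Pn[y ys]] _.
  have [d' df' nd'] : exists2 d', d' \in f & edge d' != y.
    have [/eqP eyd|nd] := boolP (edge d == y); last by exists d.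
    exists (fs d); first by rewrite ef inE fconnect1.
    have dD' : d \in D by case/setDP: dD.
    have adjd : e d.1 d.2 by rewrite -dartE.
    rewrite -eyd; apply/eqP => /edge_eq[].
      by move/(congr1 fst)/esym/eqP; apply/negP; apply: adj_neq.
    by move/(congr1 snd)/eqP; apply/negP; apply: no_turn_back.
  exists d'.1, d'.2; split; first by rewrite es; apply/eset_boundaryP; exists d'.
  by move=> s1 c1 [<- _]; exists y => //; rewrite eq_sym.
have [L [gL eL kL sL]] := build_ladder inn U srt ab next.
exists a, b, L.
have L0 : L != [::] by case: (L) gL.
have eG := union_face_graphs a b L0; rewrite gL in eG.
have allE x : x \in E -> x \in ledges a b L.
  case/edgeC => t tc xt; rewrite -[ledges _ _ _]/(eset (lgraph a b L)).
  have tL : t \in face_graphs a b L by rewrite gL.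
  by have [_ /subsetP] := face_graphs_sub tL; apply.
have allV v : v \in a :: b :: lverts L.
  have [z vz _] := ext_dart outer v.
  by apply: (ledges_sub (allE _ (edge_mem vz))); rewrite set21.
(* The inner darts number twice the edges minus the vertices; subtracting two per inner face leaves,
   by Euler's formula, two less than the number of vertices. *)
have cV : (size (lverts L)).+2 = #|G|.
  have := card_inner G; have := card_darts G; have := card_ext conn2 outer.
  have <- : D :&: ext = ext by apply/setIidPr/subsetP => d /ext_sub.
  have sLn : size L = #|inner G| by rewrite -sizeC -gL size_face_graphs.
  rewrite -(cardsID ext D) -sumC sL sLn.
  move: #|inner G| #|edges _| #|D :&: ext| (size _) #|G| => n1 n2 n3 n4 n5; lia.
(* The list meets every vertex and is no longer than the number of vertices, so nothing in it is
   repeated. *)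
have uV : uniq (a :: b :: lverts L).
  have sub : {subset enum G <= a :: b :: lverts L} by move=> v _; apply: allV.
  by apply: (leq_size_uniq (enum_uniq G) sub); rewrite -cardE /= cV.
split=> //; first by rewrite /wf_ladder uV.
congr pair.
  by apply/setP => v; rewrite !inE; apply/esym; have := allV v; rewrite !inE.
apply/setP => x; apply/idP/idP; first exact: allE.
have -> : ledges a b L = eset (union_graph (s :: c)) by rewrite eG.
case/union_eset => t tc; have [f fi ->] := inn t tc.
exact: (subsetP (eset_boundary_sub fi)).
Qed.

End Faces.

Theorem theorem4p15 (G : plane_graph) (c Bs : seq (graph G)) :
  even_polygonal_chain G ->
  left_to_right c ->
  all_kink_decomposition (graph_of G) c Bs ->
  Af (graph_of G) = \sum_(B <- Bs) cyclomatic B.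
Proof.
move=> [conn2 bip outer _] /(chain_ladder conn2 outer bip).
move=> [a [b [L [wf lK L0 -> ->]]]] dec.
by rewrite Af_ladder // (decomposition_sum wf L0 dec).
Qed.
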